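(* Let $A$ be a self-adjoint operator with simple discrete spectrum $(\lambda_n)_{n\in I}$ in a separable infinite-dimensional Hilbert space $H$, with $\inf_{n\in I}|\lambda_{n+1}-\lambda_n|=:d>0$, let $\varphi,\psi\in H$ be non-zero, and let $B=A+\langle\,\cdot\,,\varphi\rangle\psi$ on $\operatorname{dom}(B)=\operatorname{dom}(A)$. Then the eigenvalues of $B$ (counted with algebraic multiplicity) can be labelled as $\mu_n$, $n\in I$, in such a way that the series $$\sum_{n\in I}|\mu_n-\lambda_n|$$ converges. In particular, all but finitely many eigenvalues of $B$ are simple.
   Context: $H$ is a complex Hilbert space with scalar product $\langle\cdot,\cdot\rangle$ linear in the first argument. The eigenvalues $\lambda_n$ of $A$ are real and simple and are listed in increasing order, where $I=\mathbb{N}$ if $A$ is bounded below and $I=\mathbb{Z}$ if $A$ is unbounded both below and above (if $A$ is bounded above one replaces $A$ by $-A$, so by convention a semibounded $A$ is bounded below). The algebraic multiplicity of an eigenvalue $\mu$ of $B$ is the dimension of its root subspace $\{y\in \operatorname{dom}(B): (B-\mu)^k y=0 \text{ for some } k\in\mathbb{N}\}$; counting eigenvalues with multiplicities always refers to algebraic multiplicities, and an eigenvalue is simple if its algebraic multiplicity is $1$. *)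

(* Defs.v *)
From mathcomp Require Export all_boot all_order all_algebra.
From mathcomp Require Export all_classical all_reals all_analysis.
From mathcomp Require Export complex.
Set Implicit Arguments.
Unset Strict Implicit.
Unset Printing Implicit Defensive.
Export Order.TTheory GRing.Theory Num.Theory.
Export numFieldNormedType.Exports.

#[global] Open Scope classical_set_scope.
#[global] Open Scope ring_scope.

(* The values of [op] outside [dom] are irrelevant: nothing below uses them. *)
Record operator (C : numClosedFieldType) (H : completeNormedModType C) :=
  Operator {
    dom : set H ;
    op :> H -> H ;
    dom0 : dom 0 ;
    domP : forall (a : C) (x y : H), dom x -> dom y -> dom (a *: x + y) ;
    opP : forall (a : C) (x y : H),
      dom x -> dom y -> op (a *: x + y) = a *: op x + op y }.

Section Spaces.
Context (C : numClosedFieldType) (H : completeNormedModType C).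

(* MathComp forms are linear in the first argument, conjugate-linear in the
   second. *)
Definition norm_from_dot (ip : {dot H for Num.conj}) : Prop :=
  forall x : H, `|x| ^+ 2 = ip x x.

Definition separable : Prop :=
  exists2 S : set H, countable S & dense S.

(* [V] (always a linear subspace below) has a basis of [n] vectors. *)
Definition has_dim (V : set H) (n : nat) : Prop :=
  exists2 e : 'I_n -> H, (forall i, V (e i)) &
    forall v, V v -> exists! c : {ffun 'I_n -> C}, v = \sum_i c i *: e i.

Definition infinite_dimensional : Prop := forall n, ~ has_dim [set: H] n.

End Spaces.

Section Operators.
Context (C : numClosedFieldType) (H : completeNormedModType C).
Implicit Types (T : operator H) (ip : {dot H for Num.conj}) (z : C) (x y : H).

(* [y] is in the domain of the adjoint of [T], with image [w]. *)
Definition adjoint_graph ip T y w : Prop :=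
  forall x, dom T x -> ip (T x) y = ip x w.

Definition self_adjoint ip T : Prop :=
  dense (dom T) /\
  forall y w, adjoint_graph ip T y w <-> (dom T y /\ T y = w).

(* The order of [C] makes [a <= b] mean that [b - a] is a nonnegative real. *)
Definition bounded_below ip T : Prop :=
  exists2 c : C, c \is Num.real &
    forall x, dom T x -> c * `|x| ^+ 2 <= ip (T x) x.

Definition bounded_above ip T : Prop :=
  exists2 c : C, c \is Num.real &
    forall x, dom T x -> ip (T x) x <= c * `|x| ^+ 2.

Definition in_resolvent_set T z : Prop :=
  exists S : {linear H -> H},
    [/\ continuous S,
        forall y, dom T (S y) /\ T (S y) - z *: S y = y &
        forall x, dom T x -> S (T x - z *: x) = x].

Definition spectrum T : set C := [set z | ~ in_resolvent_set T z].

Definition is_eigenvalue T z : Prop :=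
  exists y, [/\ dom T y, y != 0 & T y = z *: y].

(* [y] lies in the domain of [(T - z) ^ k] when the first [k] iterates, from
   the [0]-th on, are in [dom T]. *)
Definition root_subspace T z : set H :=
  [set y | dom T y /\ exists k : nat,
     (forall j, (j < k)%N -> dom T (iter j (fun x => T x - z *: x) y)) /\
     iter k (fun x => T x - z *: x) y = 0].

Definition has_alg_mult T z (m : nat) : Prop := has_dim (root_subspace T z) m.

Definition simple_eigenvalue T z : Prop :=
  is_eigenvalue T z /\ has_alg_mult T z 1.

Definition discrete_spectrum T : Prop :=
  forall z, spectrum T z ->
    [/\ isolated (spectrum T) z, is_eigenvalue T z &
        exists m, has_alg_mult T z m].

(* The family [mu] indexed by [I] lists exactly the eigenvalues of [T], each
   one as many times as its algebraic multiplicity, which is finite. *)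
Definition labels_eigenvalues T (I : set int) (mu : int -> C) : Prop :=
  (forall n, I n -> is_eigenvalue T (mu n)) /\
  forall z, is_eigenvalue T z ->
    exists2 m, has_alg_mult T z m &
      ([set n | I n /\ mu n = z] #= `I_m)%card.

(* The index set is realized inside [int]: [N] as the nonnegative integers. *)
Definition index_set ip T (I : set int) : Prop :=
  (bounded_below ip T /\ I = [set n | 0 <= n]) \/
  (~ bounded_below ip T /\ ~ bounded_above ip T /\ I = [set: int]).

End Operators.

Section RankOne.
Context (C : numClosedFieldType) (H : completeNormedModType C).
Variables (ip : {dot H for Num.conj}) (T : operator H) (phi psi : H).

Let f x := T x + ip x phi *: psi.

Lemma rank_one_opP (a : C) (x y : H) :
  dom T x -> dom T y -> f (a *: x + y) = a *: f x + f y.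
Proof.
move=> Tx Ty; rewrite /f opP// linearPl/= scalerDr scalerA scalerDl.
by rewrite addrACA.
Qed.

Definition rank_one_perturbation : operator H :=
  Operator (dom0 T) (@domP _ _ T) rank_one_opP.

End RankOne.

Section Enumeration.
Local Open Scope complex_scope.
Context (R : realType) (H : completeNormedModType R[i]).

Definition simple_discrete_spectrum (T : operator H) (I : set int)
    (lambda : int -> R) : Prop :=
  [/\ discrete_spectrum T,
      forall z, spectrum T z -> simple_eigenvalue T z,
      forall m n, I m -> I n -> m < n -> lambda m < lambda n &
      spectrum T = [set (lambda n)%:C | n in I]].

End Enumeration.

(* Main.v *)
From HB Require Import structures.
Require Import Defs.
From mathcomp Require Import zify ring lra.

(**
Let [e k] be the normalized eigenvectors of [A]. They form a basis: on their
orthocomplement [A - t] is bounded below for every real [t] (at an eigenvalue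
this uses that it is isolated), while a bounded symmetric resolvent attains its
norm as an approximate eigenvalue.

For large [n] the adjoint perturbation [A + <., psi> phi] has an eigenvector
[f n] with eigenvalue [conj (mu n)], where [mu n - l n] is found as the fixed
point of a contraction and is bounded by [2 |<phi, e n>| |<psi, e n>|], which is
summable. Since [f n - e n] is of size [|<psi, e n>|], replacing a tail of the
basis by the vectors [f n] gives a family with a biorthogonal system. Then the
vectors orthogonal to [f n] for all [n >= m] form an [m]-dimensional space that
is invariant under the resolvent [S] of [B], and outside of it [S] acts
triangularly with diagonal entries [1 / (mu n - z)]. For [m] large these entries
are not eigenvalues of the finite block, so that the [m] eigenvalues of the block
and the numbers [mu n], [n >= m], exhaust the spectrum with multiplicities.
*)

Set Implicit Arguments.
Unset Strict Implicit.
Unset Printing Implicit Defensive.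

(** * Modulus and Hilbert norm as real numbers *)

Section Modulus.
Context (R : realType).
Implicit Types (z w : R[i]) (t : R).

(** Discreteness of the spectrum is given only as isolated eigenvalues of finite multiplicity,
    without any compactness; this is why completeness of the eigenvectors has to be derived from
    norm estimates. Adjoint eigenvectors are used because pairing with [f n] diagonalizes the
    resolvent of the perturbed operator: [ip (S x) (f n)] is a multiple of [ip x (f n)] for every
    [x]. Root vectors are then read off from coordinates, without contour integrals or determinants.
    Working with [S] instead of the unbounded operator removes all domain conditions on iterates;
    [root_subspace_resolvent] translates back. Only a tail of the basis can be replaced, since the
    vectors [f n] exist and are close to [e n] only far out. The price is a finite block without any
    structure, which is left to linear algebra over an algebraically closed field. Its eigenvalues
    enter the series in finitely many terms, so their position does not matter; the tail is summable
    by [2ab <= a^2 + b^2] and Bessel. As any labelling is allowed, the order of [I] matters only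
    through the pairwise separation of the [lambda n], and [I] can be enumerated by [nat]. *)

Definition modulus z : R := complex.Re `|z|.

Lemma modulusE z : `|z| = (modulus z)%:C%C.
Proof. by rewrite /modulus RRe_real// normr_real. Qed.

Lemma modulus_ge0 z : 0 <= modulus z.
Proof. by rewrite -ler0c -modulusE. Qed.

Lemma modulusM z w : modulus (z * w) = modulus z * modulus w.
Proof. by apply: complexI; rewrite rmorphM/= -!modulusE normrM. Qed.

Lemma modulusV z : modulus z^-1 = (modulus z)^-1.
Proof. by apply: complexI; rewrite fmorphV/= -!modulusE normfV. Qed.

Lemma modulusN z : modulus (- z) = modulus z.
Proof. by rewrite /modulus normrN. Qed.

Lemma modulusBC z w : modulus (z - w) = modulus (w - z).
Proof. by rewrite -modulusN opprB. Qed.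

Lemma modulusJ z : modulus z^* = modulus z.
Proof. by rewrite /modulus norm_conjC. Qed.

Lemma ler_modulusD z w : modulus (z + w) <= modulus z + modulus w.
Proof. by rewrite -lecR rmorphD/= -!modulusE ler_normD. Qed.

Lemma modulus_real t : modulus t%:C%C = `|t|.
Proof. by rewrite /modulus normc_def/= expr0n addr0 sqrtr_sqr. Qed.

Lemma modulus0 : modulus 0 = 0.
Proof. by rewrite /modulus normr0. Qed.

Lemma modulus1 : modulus 1 = 1.
Proof. by rewrite /modulus normr1. Qed.

Lemma modulus_eq0 z : (modulus z == 0) = (z == 0).
Proof. by rewrite -[RHS]normr_eq0 modulusE (inj_eq (@complexI R) _ 0). Qed.

Lemma modulus_gt0 z : (0 < modulus z) = (z != 0).
Proof. by rewrite lt_def modulus_eq0 modulus_ge0 andbT. Qed.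

Lemma ler_modulusB z w : modulus z - modulus w <= modulus (z - w).
Proof. by rewrite lerBlDr (le_trans _ (ler_modulusD _ _))// subrK. Qed.

Lemma ReD z w : complex.Re (z + w) = complex.Re z + complex.Re w.
Proof. by case: z w => [? ?] [? ?]. Qed.

Lemma ReN z : complex.Re (- z) = - complex.Re z.
Proof. by case: z. Qed.

Lemma ReZ t z : complex.Re (t%:C%C * z) = t * complex.Re z.
Proof. by case: z => a b /=; rewrite mul0r subr0. Qed.

Lemma ReJ z : complex.Re z^* = complex.Re z.
Proof. by case: z. Qed.

Lemma ler_Im_modulus z : `|complex.Im z| <= modulus z.
Proof.
rewrite /modulus normc_def/= -sqrtr_sqr ler_wsqrtr// lerDr.
exact: sqr_ge0.
Qed.

Lemma mulcJ z : z * z^* = ((modulus z) ^+ 2)%:C%C.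
Proof. by rewrite -normCK modulusE rmorphXn. Qed.

Lemma conjc_realE t : (t%:C%C)^* = t%:C%C.
Proof. exact: (conjc_real t). Qed.

(** Lets bounds on real parts be upgraded to bounds on moduli, by rotating one argument of the
    scalar product. *)
Lemma rotation z : exists2 a : R[i], modulus a = 1 & a * z = (modulus z)%:C%C.
Proof.
have [->|z0] := eqVneq z 0; first by exists 1; rewrite ?modulus1// mulr0 modulus0.
have m0 : modulus z != 0 by rewrite modulus_eq0.
exists (z^* * ((modulus z)^-1)%:C%C).
  by rewrite modulusM modulusJ modulus_real ger0_norm ?invr_ge0 ?modulus_ge0// divff.
rewrite mulrAC [_ * z]mulrC mulcJ -rmorphM/=; congr (_%:C%C).
by rewrite expr2 mulfK.
Qed.

End Modulus.

Section Hilbert.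
Context (R : realType) (H : completeNormedModType R[i]).
Context (ip : {dot H for Num.conj}) (hip : norm_from_dot ip).
Implicit Types (x y : H) (a : R[i]).

Definition rnorm x : R := complex.Re `|x|.

Lemma rnormE x : `|x| = (rnorm x)%:C%C.
Proof. by rewrite /rnorm RRe_real// ger0_real. Qed.

Lemma rnorm_ge0 x : 0 <= rnorm x.
Proof. by rewrite -ler0c -rnormE. Qed.

Lemma rnorm0 : rnorm 0 = 0.
Proof. by rewrite /rnorm normr0. Qed.

Lemma rnorm_eq0 x : (rnorm x == 0) = (x == 0).
Proof. by rewrite -[RHS]normr_eq0 rnormE (inj_eq (@complexI R) _ 0). Qed.

Lemma rnorm_gt0 x : (0 < rnorm x) = (x != 0).
Proof. by rewrite lt_def rnorm_eq0 rnorm_ge0 andbT. Qed.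

Lemma rnormN x : rnorm (- x) = rnorm x.
Proof. by rewrite /rnorm normrN. Qed.

Lemma rnormBC x y : rnorm (x - y) = rnorm (y - x).
Proof. by rewrite -rnormN opprB. Qed.

Lemma ler_rnormD x y : rnorm (x + y) <= rnorm x + rnorm y.
Proof. by rewrite -lecR rmorphD/= -!rnormE ler_normD. Qed.

Lemma ler_dist_rnormD z x y : rnorm (x - y) <= rnorm (x - z) + rnorm (z - y).
Proof. by rewrite (le_trans _ (ler_rnormD _ _))// addrA subrK. Qed.

Lemma rnormZ a x : rnorm (a *: x) = modulus a * rnorm x.
Proof. by apply: complexI; rewrite rmorphM/= -rnormE normrZ modulusE -rnormE. Qed.

Lemma ipxx x : ip x x = (rnorm x ^+ 2)%:C%C.
Proof. by rewrite -hip rnormE rmorphXn. Qed.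

Lemma ipC x y : ip x y = (ip y x)^*.
Proof. by have := hermC ip x y; rewrite /= expr0 mul1r. Qed.

Lemma ipDl x y z : ip (x + y) z = ip x z + ip y z.
Proof. by rewrite linearDl. Qed.

Lemma ipDr x y z : ip z (x + y) = ip z x + ip z y.
Proof. by rewrite linearDr. Qed.

Lemma ipBl x y z : ip (x - y) z = ip x z - ip y z.
Proof. by rewrite linearBl. Qed.

Lemma ipBr x y z : ip z (x - y) = ip z x - ip z y.
Proof. by rewrite linearBr. Qed.

Lemma ipZl a x z : ip (a *: x) z = a * ip x z.
Proof. by rewrite linearZl_LR. Qed.

Lemma ipZr a x z : ip z (a *: x) = a^* * ip z x.
Proof. by rewrite linearZr_LR. Qed.

Lemma ip0l x : ip 0 x = 0.
Proof. by rewrite linear0l. Qed.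

Lemma ip0r x : ip x 0 = 0.
Proof. by rewrite linear0r. Qed.

Lemma ip_eq0C x y : ip x y = 0 -> ip y x = 0.
Proof. by move=> xy; rewrite ipC xy rmorph0. Qed.

Lemma ip_suml I (r : seq I) (P : pred I) (F : I -> H) z :
  ip (\sum_(i <- r | P i) F i) z = \sum_(i <- r | P i) ip (F i) z.
Proof.
by elim/big_rec2: _ => [|i y1 y2 _ <-]; rewrite ?ip0l// ipDl.
Qed.

Lemma sqr_rnormD x y :
  rnorm (x + y) ^+ 2 = rnorm x ^+ 2 + rnorm y ^+ 2 + complex.Re (ip x y) *+ 2.
Proof.
apply: (@complexI R); rewrite -ipxx !(ipDl, ipDr) !ipxx (ipC y x).
set w := ip x y.
have -> : w^* = (complex.Re w *+ 2)%:C%C - w.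
  by apply/eqP; rewrite eq_sym subr_eq addrC; have := addcJ w => /= ->; rewrite mulr_natl -rmorphMn.
rewrite !rmorphD /=; ring.
Qed.

Lemma sqr_rnormB x y :
  rnorm (x - y) ^+ 2 = rnorm x ^+ 2 + rnorm y ^+ 2 - complex.Re (ip x y) *+ 2.
Proof.
by rewrite sqr_rnormD rnormN -scaleN1r ipZr rmorphN rmorph1 mulN1r ReN mulNrn.
Qed.

Lemma parallelogram x y : rnorm (x + y) ^+ 2 + rnorm (x - y) ^+ 2 =
  rnorm x ^+ 2 *+ 2 + rnorm y ^+ 2 *+ 2.
Proof. by rewrite sqr_rnormD sqr_rnormB; ring. Qed.

Lemma pythagoras x y :
  ip x y = 0 -> rnorm (x + y) ^+ 2 = rnorm x ^+ 2 + rnorm y ^+ 2.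
Proof. by move=> xy; rewrite sqr_rnormD xy mul0rn addr0. Qed.

(** Cauchy-Schwarz is obtained backwards here: the norm is given with its triangle inequality, and
    squaring that inequality leaves the real part of the scalar product. *)
Lemma Re_ip_le x y : complex.Re (ip x y) <= rnorm x * rnorm y.
Proof.
have : rnorm (x + y) ^+ 2 <= (rnorm x + rnorm y) ^+ 2.
  by rewrite lerXn2r ?nnegrE ?addr_ge0 ?rnorm_ge0// ler_rnormD.
rewrite sqr_rnormD; nra.
Qed.

Lemma modulus_ip_le x y : modulus (ip x y) <= rnorm x * rnorm y.
Proof.
have [a a1 aE] := rotation (ip x y).
have := Re_ip_le (a *: x) y.
by rewrite ipZl aE/= rnormZ a1 mul1r.
Qed.

Lemma cauchy_complete (u : nat -> H) :
  (forall e : R, 0 < e ->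
    exists N, forall m n, (N <= m)%N -> (N <= n)%N -> rnorm (u m - u n) < e) ->
  exists l, forall e : R, 0 < e ->
    exists N, forall n, (N <= n)%N -> rnorm (u n - l) < e.
Proof.
move=> cu.
have : cauchy (u @ \oo).
  apply/cauchyP => eps eps0.
  have epsE : eps = (complex.Re eps)%:C%C by rewrite RRe_real// ger0_real// ltW.
  have [N NP] := cu (complex.Re eps) ltac:(by rewrite -ltcR -epsE).
  exists (u N); exists N => // n /= Nn.
  by rewrite -ball_normE/= rnormE epsE ltcR; apply: NP.
move/cauchy_cvg => /cvg_ex[l ul]; exists l => e e0.
have e0' : 0 < e%:C%C :> R[i] by rewrite ltcR.
have [N _ NP] := cvg_ball ul e0'.
exists N => n Nn; have := NP n Nn.
by rewrite -ball_normE/= rnormE ltcR rnormBC.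
Qed.

Lemma rnorm_small_eq0 x : (forall e : R, 0 < e -> rnorm x <= e) -> x = 0.
Proof.
move=> xe; apply/eqP; rewrite -rnorm_eq0 eq_le rnorm_ge0 andbT.
by apply/ler_addgt0Pr => e e0; rewrite add0r xe.
Qed.

Lemma expr_lt_eventually (q e : R) : 0 <= q -> q < 1 -> 0 < e ->
  exists N : nat, forall n, (N <= n)%N -> q ^+ n < e.
Proof.
move=> q0 q1 e0; have q1' : `|q| < 1 by rewrite ger0_norm.
have := cvg_expr q1' => /cvgrPdist_lt/(_ e e0)[N _ NP].
exists N => n Nn; have := NP n Nn.
by rewrite sub0r normrN ger0_norm// exprn_ge0.
Qed.

Lemma contraction_fixpoint (F : H -> H) (x0 : H) (r q : R) :
  0 <= q -> q < 1 -> 0 <= r ->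
  (forall x, rnorm (x - x0) <= r -> rnorm (F x - x0) <= r) ->
  (forall x y, rnorm (x - x0) <= r -> rnorm (y - x0) <= r ->
    rnorm (F x - F y) <= q * rnorm (x - y)) ->
  exists2 x, rnorm (x - x0) <= r & F x = x.
Proof.
move=> q0 q1 r0 Fr Fq; pose u n := iter n F x0.
have ur n : rnorm (u n - x0) <= r.
  by elim: n => [|n ih]; rewrite ?subrr ?rnorm0//= Fr.
(* Every iterate stays in the ball, so [u k] is within [r] of [u 0]; applying [F] to both sides [n]
   times yields [q ^+ n * r] without summing a geometric series. *)
have ud n k : rnorm (u n - u (n + k)%N) <= q ^+ n * r.
  elim: n k => [|n ih] k; first by rewrite expr0 mul1r rnormBC.
  by rewrite addSn /= exprS -mulrA (le_trans (Fq _ _ _ _))// ler_wpM2l.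
have cu : forall e : R, 0 < e ->
    exists N, forall m n, (N <= m)%N -> (N <= n)%N -> rnorm (u m - u n) < e.
  move=> e e0; have d0 : 0 < e / (2 * (r + 1)).
    by rewrite divr_gt0// mulr_gt0// ltr_wpDl.
  have [N NP] := expr_lt_eventually q0 q1 d0; exists N => m n Nm Nn.
  have h k : (N <= k)%N -> rnorm (u N - u k) <= q ^+ N * r.
    by move=> Nk; rewrite -(subnKC Nk).
  rewrite (le_lt_trans (ler_dist_rnormD (u N) _ _))//.
  rewrite (rnormBC (u m)).
  apply: le_lt_trans (lerD (h m Nm) (h n Nn)) _.
  have eE : e = e / (2 * (r + 1)) * (r + 1) *+ 2 by field; lra.
  rewrite -mulr2n [ltRHS]eE ltrMn2r/=.
  have := NP N (leqnn _); have := exprn_ge0 N q0; nra.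
have [l lP] := cauchy_complete cu.
have lr : rnorm (l - x0) <= r.
  apply/ler_addgt0Pr => e e0; have [N NP] := lP _ e0.
  rewrite (le_trans (ler_dist_rnormD (u N) _ _))// addrC lerD//.
  by rewrite rnormBC ltW// NP.
exists l => //; apply/eqP; rewrite -subr_eq0; apply/eqP/rnorm_small_eq0 => e e0.
have [N NP] := lP (e / 2) ltac:(by rewrite divr_gt0).
rewrite (le_trans (ler_dist_rnormD (u N.+1) _ _))//.
have h1 : rnorm (F l - u N.+1) <= rnorm (l - u N).
  by rewrite (le_trans (Fq _ _ _ _))// ler_piMl ?rnorm_ge0// ltW.
have := NP N (leqnn _); have := NP N.+1 (leqnSn _).
rewrite [in X in _ -> X -> _]rnormBC; lra.
Qed.

End Hilbert.

(** * Projection onto a subspace *)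

Section Projection.
Context (R : realType) (H : completeNormedModType R[i]).
Context (ip : {dot H for Num.conj}) (hip : norm_from_dot ip).

Definition linear_subspace (V : set H) :=
  V 0 /\ forall (a : R[i]) x y, V x -> V y -> V (a *: x + y).

Lemma subspaceD V x y : linear_subspace V -> V x -> V y -> V (x + y).
Proof. by move=> [_ VP] Vx Vy; rewrite -[x]scale1r; apply: VP. Qed.

Lemma subspaceZ V a x : linear_subspace V -> V x -> V (a *: x).
Proof. by move=> [V0 VP] Vx; rewrite -[X in V X]addr0; apply: VP. Qed.

Lemma minimal_orthogonal (V : set H) v : linear_subspace V ->
  (forall u, V u -> rnorm v <= rnorm (v - u)) -> forall u, V u -> ip v u = 0.
Proof.
move=> Vs vmin u Vu; apply/eqP; rewrite -modulus_eq0; apply/eqP.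
have [a a1 aE] := rotation (ip v u).
have [u0|u0] := eqVneq u 0; first by rewrite u0 ip0r modulus0.
have n0 : 0 < rnorm u by rewrite rnorm_gt0.
set m := modulus _ in aE *; have m0 : 0 <= m by exact: modulus_ge0.
have h (t : R) : rnorm v ^+ 2 <= rnorm v ^+ 2 + t ^+ 2 * rnorm u ^+ 2 - (t * m) *+ 2.
  have := vmin (t%:C%C *: (a^* *: u)) (subspaceZ _ Vs (subspaceZ _ Vs Vu)).
  rewrite -(@ler_pXn2r _ 2) ?nnegrE ?rnorm_ge0// (sqr_rnormB hip).
  rewrite !ipZr conjCK aE conjc_realE -rmorphM /=.
  by rewrite !rnormZ modulus_real modulusJ a1 mul1r exprMn real_normK ?num_real.
(* This value of [t] minimizes the quadratic polynomial on the right of [h]. *)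
have := h (m / rnorm u ^+ 2); rewrite exprMn exprVn.
set U := rnorm u ^+ 2; have U0 : 0 < U by rewrite exprn_gt0.
have -> : m ^+ 2 * (U ^+ 2)^-1 * U = m ^+ 2 / U by field; lra.
have -> : m / U * m = m ^+ 2 / U by rewrite mulrAC.
have : 0 <= m ^+ 2 / U by rewrite divr_ge0 ?sqr_ge0 ?ltW.
move=> h1 h2; have : m ^+ 2 / U = 0 by lra.
by move/eqP; rewrite mulf_eq0 invr_eq0 (gt_eqF U0) orbF sqrf_eq0 => /eqP.
Qed.

(** The double orthocomplement of [V] lies in the closure of [V]. A minimizing sequence in [V]
    converges to some [l], and [x - l] is orthogonal to [V]. [V] need not be closed, hence the
    conclusion by approximation. *)
Lemma approx_of_orthogonal (V : set H) x : linear_subspace V ->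
  (forall v, (forall u, V u -> ip v u = 0) -> ip v x = 0) ->
  forall e : R, 0 < e -> exists2 u, V u & rnorm (x - u) < e.
Proof.
move=> Vs xV; pose S := [set rnorm (x - u) | u in V].
have Sinf : has_inf S.
  split; first by exists (rnorm (x - 0)); exists 0 => //; case: Vs.
  by exists 0 => _ [u _ <-]; exact: rnorm_ge0.
have Sge u : V u -> inf S <= rnorm (x - u).
  by move=> Vu; apply: ge_inf; [case: Sinf|exists u].
set de := inf S in Sge.
have de0 : 0 <= de by apply: lb_le_inf; [case: Sinf|move=> _ [u _ <-]; exact: rnorm_ge0].
have /choice[u uP] : forall n : nat, exists u, V u /\ rnorm (x - u) < de + n.+1%:R^-1.
  move=> n; have e0 : (0 : R) < n.+1%:R^-1 by rewrite invr_gt0.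
  by have [_ [u Vu <-] ulen] := inf_adherent e0 Sinf; exists u.
have small (e : R) : 0 < e -> exists N, forall n, (N <= n)%N -> rnorm (x - u n) < de + e.
  move=> e0; have [N] := ltr_add_invr e0; rewrite add0r => NP.
  exists N => n Nn; apply: (lt_trans (uP n).2); rewrite ltrD2l.
  by apply: le_lt_trans NP; rewrite lef_pV2 ?posrE// ler_nat ltnS.
(* The midpoint of [u m] and [u n] lies in [V], so its distance to [x] is at least [de]. The
   parallelogram law leaves [4 (de + e)^2 - 4 de^2 = 8 de e + 4 e^2], and [e <= 1] makes this linear
   in [e]. *)
have near m n e : 0 < e -> e <= 1 -> rnorm (x - u m) < de + e -> rnorm (x - u n) < de + e ->
    rnorm (u m - u n) ^+ 2 <= (8 * de + 4) * e.
  move=> e0 e1 hm hn; have := parallelogram hip (x - u m) (x - u n).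
  have -> : x - u m - (x - u n) = - (u m - u n).
    by rewrite !opprB addrC subrKA.
  rewrite rnormN.
  have -> : x - u m + (x - u n) = 2%:C%C *: (x - (2^-1)%:C%C *: (u m + u n)).
    rewrite scalerBr scalerA -rmorphM/= divff ?pnatr_eq0// scale1r addrACA -opprD.
    by rewrite rmorphD/= scalerDl scale1r.
  rewrite rnormZ modulus_real normr_nat exprMn.
  have := Sge ((2^-1)%:C%C *: (u m + u n)) (subspaceZ _ Vs (subspaceD Vs (uP m).1 (uP n).1)).
  move: (rnorm_ge0 (x - u m)) (rnorm_ge0 (x - u n)) hm hn.
  set a := rnorm (x - u m); set b := rnorm (x - u n); set c := rnorm (x - _).
  set D := rnorm _ ^+ 2 => a0 b0 hm hn hc E.
  have c2 : de ^+ 2 <= c ^+ 2 by apply: lerXn2r; rewrite ?nnegrE//; lra.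
  have a2 : a ^+ 2 <= (de + e) ^+ 2 by apply: lerXn2r; rewrite ?nnegrE//; lra.
  have b2 : b ^+ 2 <= (de + e) ^+ 2 by apply: lerXn2r; rewrite ?nnegrE//; lra.
  have ee : e ^+ 2 <= e by rewrite expr2 ler_piMl// ltW.
  nra.
have cu (e : R) : 0 < e ->
    exists N, forall m n, (N <= m)%N -> (N <= n)%N -> rnorm (u m - u n) < e.
  move=> e0; pose d := Num.min 1 (e ^+ 2 / (2 * (8 * de + 4))).
  have K0 : 0 < 8 * de + 4 by lra.
  have d0 : 0 < d by rewrite lt_min ltr01/= divr_gt0 ?exprn_gt0 ?mulr_gt0.
  have d1 : d <= 1 by rewrite ge_min lexx.
  have [N NP] := small _ d0; exists N => m n Nm Nn.
  rewrite -(@ltr_pXn2r _ 2) ?nnegrE ?rnorm_ge0 ?(ltW e0)//.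
  apply: le_lt_trans (near _ _ _ d0 d1 (NP _ Nm) (NP _ Nn)) _.
  have dle : d <= e ^+ 2 / (2 * (8 * de + 4)) by rewrite ge_min lexx orbT.
  have {dle} : (8 * de + 4) * d <= e ^+ 2 / 2.
    apply: le_trans (ler_wpM2l (ltW K0) dle) _.
    by rewrite le_eqVlt; apply/orP; left; apply/eqP; field; lra.
  have : 0 < e ^+ 2 by rewrite exprn_gt0.
  lra.
have [l lP] := cauchy_complete cu.
have vmin w : V w -> rnorm (x - l) <= rnorm (x - l - w).
  move=> Vw; apply/ler_addgt0Pr => e e0.
  have e4 : 0 < e / 4 by rewrite divr_gt0.
  have [N1 N1P] := small _ e4; have [N2 N2P] := lP _ e4.
  pose n := maxn N1 N2; have h1 := N1P n (leq_maxl _ _); have h2 := N2P n (leq_maxr _ _).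
  have h3 := Sge (u n + w) (subspaceD Vs (uP n).1 Vw).
  have h4 : rnorm (x - (u n + w)) <= rnorm (x - l - w) + rnorm (u n - l).
    have -> : x - (u n + w) = (x - l - w) - (u n - l).
      by rewrite opprB addrACA subrK -opprD [w + _]addrC.
    by rewrite -(rnormN (u n - l)) ler_rnormD.
  have h5 := ler_dist_rnormD (u n) x l; lra.
(* [x - l] is orthogonal to [x] by the assumption on [x], and to [l] as a limit of vectors of [V];
   so its norm vanishes. *)
have xl : x = l.
  apply/eqP; rewrite -subr_eq0 -rnorm_eq0 -sqrf_eq0; apply/eqP/(@complexI R).
  have orth := minimal_orthogonal Vs vmin.
  rewrite -(ipxx hip) ipBr xV// sub0r.
  apply/eqP; rewrite oppr_eq0 -modulus_eq0 eq_le modulus_ge0 andbT.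
  apply/ler_addgt0Pr => e e0; rewrite add0r.
  have f0 : 0 < e / (rnorm (x - l) + 1) by rewrite divr_gt0// ltr_wpDl ?rnorm_ge0.
  have [N NP] := lP _ f0; have := NP N (leqnn _).
  have -> : ip (x - l) l = - ip (x - l) (u N - l).
    by rewrite ipBr (orth _ (uP N).1) sub0r opprK.
  rewrite modulusN ltr_pdivlMr ?ltr_wpDl ?rnorm_ge0// => hN.
  apply: le_trans (modulus_ip_le hip _ _) _.
  have := rnorm_ge0 (u N - l); have := rnorm_ge0 (x - l); nra.
move=> e e0; have [N NP] := lP _ e0; exists (u N); first by case: (uP N).
by rewrite xl rnormBC NP.
Qed.

End Projection.

(** * Spectral bounds for a self-adjoint operator *)

Section Spectral.
Context (R : realType) (H : completeNormedModType R[i]).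
Context (ip : {dot H for Num.conj}) (hip : norm_from_dot ip).

Lemma linear_bounded (S : {linear H -> H}) : continuous S ->
  exists2 M : R, 0 < M & forall x, rnorm (S x) <= M * rnorm x.
Proof.
move=> cS; have /linear_boundedP[M [Mr MP]] := continuous_linear_bounded 0 (cS 0).
exists (`|complex.Re M| + 1) => [|x]; first by rewrite ltr_wpDl.
rewrite -lecR rmorphM/= -!rnormE; apply: MP.
by rewrite -[M]RRe_real// ltcR/= ltr_pwDr// ler_norm.
Qed.

(** [N] is the norm of [S] on [V]. On an almost norming vector [S^2 - N^2] is small, by symmetry; it
    factors as [(S - N)(S + N)], so that not both factors can be bounded below. *)
Lemma symmetric_norm_attained (V : set H) (S : {linear H -> H}) (M : R) :
  linear_subspace V -> (forall x, V x -> V (S x)) ->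
  (forall x y, V x -> V y -> ip (S x) y = ip x (S y)) ->
  (forall x, rnorm (S x) <= M * rnorm x) ->
  (exists2 x, V x & S x != 0) ->
  exists N : R, [/\ 0 < N, forall x, V x -> rnorm (S x) <= N * rnorm x &
    forall c : R, 0 < c ->
      (forall y, V y -> c * rnorm y <= rnorm (S y - N%:C%C *: y)) ->
      (forall y, V y -> c * rnorm y <= rnorm (S y + N%:C%C *: y)) -> False].
Proof.
move=> Vs VS Ssym SM [x0 Vx0 Sx0].
pose E := [set rnorm (S x) | x in [set x | V x /\ rnorm x <= 1]].
have M0 : 0 <= M.
  have : x0 != 0 by apply: contraNneq Sx0 => ->; rewrite linear0.
  rewrite -rnorm_gt0 => p; have := le_trans (rnorm_ge0 _) (SM x0).
  by rewrite pmulr_lge0.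
have Esup : has_sup E.
  split; first by exists (rnorm (S 0)), 0 => //; split; [case: Vs|rewrite rnorm0].
  exists M => _ [x [Vx x1] <-]; apply: le_trans (SM x) _.
  by rewrite ler_piMr.
have Ele x : V x -> rnorm x <= 1 -> rnorm (S x) <= sup E.
  by move=> Vx x1; apply: ub_le_sup; [case: Esup|exists x].
set N := sup E in Ele *.
have SN x : V x -> rnorm (S x) <= N * rnorm x.
  move=> Vx; have [->|x_n0] := eqVneq x 0; first by rewrite linear0 rnorm0 mulr0.
  have p : 0 < rnorm x by rewrite rnorm_gt0.
  have := Ele (((rnorm x)^-1)%:C%C *: x) (subspaceZ _ Vs Vx).
  have p1 : 0 < (rnorm x)^-1 by rewrite invr_gt0.
  rewrite linearZ/= !rnormZ modulus_real (gtr0_norm p1) mulVf ?gt_eqF//.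
  by rewrite mulrC ler_pdivrMr//; apply.
have N0 : 0 < N.
  have p : 0 < rnorm (S x0) by rewrite rnorm_gt0.
  have := lt_le_trans p (SN _ Vx0); have := rnorm_ge0 x0; nra.
exists N; split => // c c0 h1 h2.
(* The first bound keeps the almost norming vector longer than [1/2], which gives the lower bound
   [c^4 / 4]. The second makes the defect [2 ep N^3] at most [c^4 / 8], a contradiction. *)
pose ep := Num.min (N / 2) (c ^+ 4 / (16 * N ^+ 3)).
have ep0 : 0 < ep.
  by rewrite lt_min !divr_gt0 ?mulr_gt0 ?exprn_gt0.
have epN : ep <= N / 2 by rewrite ge_min lexx.
have epc : ep * (16 * N ^+ 3) <= c ^+ 4.
  by rewrite -ler_pdivlMr ?mulr_gt0 ?exprn_gt0// ge_min lexx orbT.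
have [_ [x [Vx x1] <-]] := sup_adherent ep0 Esup.
rewrite -/N => Sx.
have V1 : V (S x + N%:C%C *: x).
  by apply: subspaceD => //; [exact: VS|exact: subspaceZ].
have := h1 _ V1.
have -> : S (S x + N%:C%C *: x) - N%:C%C *: (S x + N%:C%C *: x)
   = S (S x) - (N ^+ 2)%:C%C *: x.
  rewrite linearD linearZ/= scalerDr scalerA -rmorphM opprD addrA addrK.
  by rewrite -expr2.
have := h2 _ Vx; set u := rnorm (_ + _) => h3 h4.
have : (c * (c * rnorm x)) ^+ 2 <= rnorm (S (S x) - (N ^+ 2)%:C%C *: x) ^+ 2.
  apply: lerXn2r; rewrite ?nnegrE ?rnorm_ge0 ?mulr_ge0 ?rnorm_ge0 ?(ltW c0)//.
  by apply: le_trans h4; rewrite ler_pM2l.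
rewrite (sqr_rnormB hip) ipZr conjc_realE ReZ (Ssym _ _ (VS _ Vx) Vx) (ipxx hip)/=.
rewrite rnormZ modulus_real ger0_norm ?sqr_ge0//.
have := SN _ Vx; have := SN _ (VS _ Vx).
move: (rnorm_ge0 (S x)) (rnorm_ge0 (S (S x))) (rnorm_ge0 x) x1 Sx.
set a := rnorm x; set b := rnorm (S x); set e := rnorm (S (S x)).
move=> b0 e0 a0 a1 Sx eb ba.
have ahalf : 1 / 2 <= a by rewrite -(ler_pM2l N0); lra.
have e2 : e ^+ 2 <= N ^+ 2 * b ^+ 2.
  by rewrite -exprMn; apply: lerXn2r; rewrite ?nnegrE ?mulr_ge0// ltW.
have b2 : (N - ep) ^+ 2 < b ^+ 2 by apply: ltrXn2r; rewrite ?nnegrE//; lra.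
have a2 : a ^+ 2 <= 1 by rewrite expr_le1.
have a2' : 1 / 4 <= a ^+ 2.
  have : (1 / 2) ^+ 2 <= a ^+ 2 by apply: lerXn2r; rewrite ?nnegrE//; lra.
  lra.
have N2 : 0 < N ^+ 2 by rewrite exprn_gt0.
have : N ^+ 2 * (b ^+ 2) >= N ^+ 2 * (N - ep) ^+ 2 by rewrite ler_pM2l// ltW.
have c4 : 0 < c ^+ 4 by rewrite exprn_gt0.
have : (N ^+ 2 * a) ^+ 2 <= N ^+ 4.
  by rewrite exprMn -exprM -[leRHS]mulr1 ler_pM2l ?exprn_gt0.
have : (c * (c * a)) ^+ 2 >= c ^+ 4 / 4.
  have -> : (c * (c * a)) ^+ 2 = c ^+ 4 * a ^+ 2 by ring.
  by rewrite ler_pM2l//; lra.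
move=> t1 t2 t3 t4.
have e2p : 0 <= N ^+ 2 * ep ^+ 2 by rewrite mulr_ge0 ?sqr_ge0.
have : c ^+ 4 / 4 <= N ^+ 4 - N ^+ 2 * (N - ep) ^+ 2 by lra.
have -> : N ^+ 4 - N ^+ 2 * (N - ep) ^+ 2 = 2 * (ep * N ^+ 3) - N ^+ 2 * ep ^+ 2 by ring.
lra.
Qed.

Context (A : operator H) (hA : self_adjoint ip A).

Lemma op_symmetric x y : dom A x -> dom A y -> ip (A x) y = ip x (A y).
Proof.
move=> Ax Ay; have [_ /(_ y (A y))[_ h]] := hA.
exact: (h (conj Ay erefl)).
Qed.

Lemma op_domZ a x : dom A x -> dom A (a *: x).
Proof. by move=> Ax; rewrite -[_ *: _]addr0; apply: domP => //; exact: dom0. Qed.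

Lemma op_domD x y : dom A x -> dom A y -> dom A (x + y).
Proof. by move=> Ax Ay; rewrite -[x]scale1r; apply: domP. Qed.

Lemma op_domB x y : dom A x -> dom A y -> dom A (x - y).
Proof. by move=> Ax Ay; rewrite addrC -scaleN1r; apply: domP. Qed.

Lemma op0 : A 0 = 0.
Proof.
have := @opP _ _ A (-1) _ _ (dom0 A) (dom0 A).
by rewrite !scaleN1r oppr0 addr0 addNr.
Qed.

Lemma opD x y : dom A x -> dom A y -> A (x + y) = A x + A y.
Proof. by move=> Ax Ay; rewrite -[x in LHS]scale1r opP// scale1r. Qed.

Lemma opZ a x : dom A x -> A (a *: x) = a *: A x.
Proof.
by move=> Ax; rewrite -[in LHS](addr0 (a *: x)) opP ?op0 ?addr0//; exact: dom0.
Qed.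

Lemma opB x y : dom A x -> dom A y -> A (x - y) = A x - A y.
Proof. by move=> Ax Ay; rewrite addrC -scaleN1r opP// scaleN1r addrC. Qed.

Lemma resolvent_bounded_below z : in_resolvent_set A z ->
  exists2 c : R, 0 < c & forall x, dom A x -> c * rnorm x <= rnorm (A x - z *: x).
Proof.
move=> [S [/linear_bounded[M M0 SM] _ SA]]; exists M^-1; first by rewrite invr_gt0.
by move=> x Ax; rewrite ler_pdivrMl// -{1}(SA x Ax).
Qed.

(** Expresses that [t] is not an approximate eigenvalue of [A] on [V]. *)
Definition bounded_below_on (V : set H) (t : R) := exists2 c : R, 0 < c &
  forall x, V x -> dom A x -> c * rnorm x <= rnorm (A x - t%:C%C *: x).

(** An approximate eigenvalue [N] or [-N] of the resolvent at [t] corresponds to the approximate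
    eigenvalue [t + 1/N] or [t - 1/N] of [A]. Thus a lower bound for [A] at both points contradicts
    the choice of [N] as the norm of [S] on [V]. *)
Lemma resolvent_norm_attained (V : set H) (S : {linear H -> H}) (t : R) :
  continuous S -> (forall y, dom A (S y) /\ A (S y) - t%:C%C *: S y = y) ->
  linear_subspace V -> (forall x, V x -> V (S x)) -> (exists2 x, V x & x != 0) ->
  exists N : R, [/\ 0 < N, forall x, V x -> rnorm (S x) <= N * rnorm x &
    ~ (bounded_below_on V (t + N^-1) /\ bounded_below_on V (t - N^-1))].
Proof.
move=> cS AS Vs VS [x0 Vx0 x0n0].
have [M M0 SM] := linear_bounded cS.
have Ssym x y : ip (S x) y = ip x (S y).
  rewrite -{1}(AS y).2 -{2}(AS x).2 ipBr ipBl ipZr ipZl conjc_realE.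
  by rewrite op_symmetric//; [exact: (AS x).1|exact: (AS y).1].
have Sx0 : S x0 != 0.
  apply: contraNneq x0n0 => Sx0.
  by rewrite -(AS x0).2 Sx0 op0 scaler0 subr0.
have [//|N [N0 SN Nc]] :=
  @symmetric_norm_attained V S M Vs VS (fun x y _ _ => Ssym x y) SM.
  by exists x0.
exists N; split=> // -[[c1 c10 h1] [c2 c20 h2]].
(* With [w = S y] one has [S y -+ N y = -+ N (A - (t +- 1/N)) w]. *)
have key (s : R) c : s = N \/ s = - N -> 0 < c ->
    (forall x, V x -> dom A x -> c * rnorm x <= rnorm (A x - (t + s^-1)%:C%C *: x)) ->
    exists2 k, 0 < k & forall y, V y -> k * rnorm y <= rnorm (S y - s%:C%C *: y).
  move=> sN c0 h.
  have sn : `|s| = N by case: sN => ->; rewrite ?normrN gtr0_norm.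
  have s0 : s != 0 by rewrite -normr_eq0 sn gt_eqF.
  have K0 : 0 < N + c^-1 by rewrite addr_gt0 ?invr_gt0.
  exists (N ^+ 2 / (N + c^-1)); first by rewrite divr_gt0 ?exprn_gt0.
  move=> y Vy; have [Aw wE] := AS y; set w := S y in Aw wE *.
  have E : w - s%:C%C *: y = (- s)%:C%C *: (A w - (t + s^-1)%:C%C *: w).
    rewrite -wE !scalerBr !scalerA -!rmorphM/= opprB.
    have -> : - s * (t + s^-1) = - (s * t + 1) by field.
    rewrite !rmorphN/= !scaleNr opprK rmorphD/= scalerDl scale1r.
    by rewrite [RHS]addrC addrA [w + _]addrC.
  have := h _ (VS _ Vy) Aw; rewrite -/w => cw.
  have En : rnorm (w - s%:C%C *: y) = N * rnorm (A w - (t + s^-1)%:C%C *: w).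
    by rewrite E rnormZ modulus_real normrN sn.
  rewrite mulrAC ler_pdivrMr//.
  have h3 : N * rnorm y <= rnorm w + rnorm (w - s%:C%C *: y).
    have := ler_rnormD w (- (w - s%:C%C *: y)).
    rewrite subKr rnormN rnormZ modulus_real sn; apply.
  have {cw} cw : N * rnorm w <= c^-1 * rnorm (w - s%:C%C *: y).
    by rewrite En mulrCA ler_pM2l// ler_pdivlMl.
  rewrite expr2 -mulrA.
  have : N * (N * rnorm y) <= N * (rnorm w + rnorm (w - s%:C%C *: y)) by rewrite ler_pM2l.
  lra.
have [k1 k10 k1P] := key N c1 (or_introl erefl) c10 h1.
have [|k2 k20 k2P] := key (- N) c2 (or_intror erefl) c20.
  by rewrite invrN.
apply: (Nc (Num.min k1 k2)) => [|y Vy|y Vy]; first by rewrite lt_min k10.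
  by apply: le_trans (k1P y Vy); rewrite ler_wpM2r ?rnorm_ge0// ge_min lexx.
have := k2P y Vy; rewrite rmorphN/= scaleNr opprK; apply: le_trans.
by rewrite ler_wpM2r ?rnorm_ge0// ge_min lexx orbT.
Qed.

End Spectral.

(** * Completeness of the eigenvectors of a self-adjoint operator with separated eigenvalues *)

Section Completeness.
Context (R : realType) (H : completeNormedModType R[i]).
Context (ip : {dot H for Num.conj}) (hip : norm_from_dot ip).
Context (A : operator H) (hA : self_adjoint ip A).
Context (l : nat -> R) (e : nat -> H) (d : R) (d0 : 0 < d).
Context (sep : forall j k, j != k -> d <= `|l j - l k|).
Context (resA : forall t : R, (forall k, t != l k) -> in_resolvent_set A t%:C%C).
Context (eA : forall k, [/\ dom A (e k), rnorm (e k) = 1 & A (e k) = (l k)%:C%C *: e k]).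
Context (kerA : forall k x, dom A x -> A x = (l k)%:C%C *: x -> x = ip x (e k) *: e k).

Lemma near_eigenvalue_gap k t : 0 < `|t - l k| -> `|t - l k| < d ->
  forall j, t != l j.
Proof.
move=> h1 h2 j; apply: contraTneq h2 => tE; rewrite -leNgt tE.
by apply: sep; apply: contraTneq h1 => jk; rewrite tE jk subrr normr0 ltxx.
Qed.

(** Were the resolvent norm [N] at this point [t] larger than [2/d], then [t + 1/N] and [t - 1/N]
    would differ from [l k] and be closer to it than [d]. Both would be in the resolvent set,
    against [resolvent_norm_attained]. *)
Lemma half_gap_bound k s x : (s = 1 \/ s = -1) -> dom A x ->
  d / 2 * rnorm x <= rnorm (A x - (l k + s * (d / 2))%:C%C *: x).
Proof.
have d_gt0 := d0.
move=> sE Ax; set t := l k + _.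
have tk : `|t - l k| = d / 2.
  rewrite /t addrC addKr; case: sE => ->.
    by rewrite mul1r gtr0_norm// divr_gt0.
  by rewrite mulN1r normrN gtr0_norm// divr_gt0.
have tres : in_resolvent_set A t%:C%C.
  by apply: resA; apply: (@near_eigenvalue_gap k); rewrite tk; lra.
have [S [cS AS SA]] := tres.
have [//|N [N0 SN]] := @resolvent_norm_attained R H ip hip A hA [set: H] S t cS AS
   (conj I (fun _ _ _ _ _ => I)) (fun _ _ => I).
  by have [_ e1 _] := eA 0; exists (e 0) => //; rewrite -rnorm_eq0 e1 oner_eq0.
have [Nd _|dN []] := leP N (2 / d).
  have : rnorm (S (A x - t%:C%C *: x)) <= N * rnorm (A x - t%:C%C *: x) by exact: SN.
  rewrite SA// => h; rewrite mulrC -ler_pdivlMr ?divr_gt0// invf_div mulrC.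
  by apply: le_trans h _; rewrite ler_wpM2r ?rnorm_ge0.
have Nd : 0 < N^-1 < d / 2.
  by rewrite invr_gt0 N0/= -[ltRHS]invrK ltf_pV2 ?posrE ?invr_gt0 ?divr_gt0// invf_div.
have nb u : `|u| = N^-1 -> bounded_below_on A [set: H] (t + u).
  move=> uN; have [|c c0 cP] := @resolvent_bounded_below R H A (t + u)%:C%C.
    apply: resA; apply: (@near_eigenvalue_gap k).
      rewrite -addrA [u + _]addrC addrA.
      have := lerB_normD (t - l k) u; rewrite tk uN; lra.
    rewrite -addrA [u + _]addrC addrA.
    have := ler_normD (t - l k) u; rewrite tk uN; lra.
  by exists c => // y _; exact: cP.
split; apply: nb; first by rewrite gtr0_norm//; lra.
by rewrite normrN gtr0_norm//; lra.
Qed.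

Lemma ReipC x y : complex.Re (ip y x) = complex.Re (ip x y).
Proof. by rewrite (ipC ip y x) ReJ. Qed.

Let s k x := A x - (l k)%:C%C *: x.

Lemma shifted_symmetric k x y : dom A x -> dom A y ->
  ip (s k x) y = ip x (s k y).
Proof.
move=> Ax Ay; rewrite /s ipBl ipBr ipZl ipZr conjc_realE (op_symmetric hA)//.
Qed.

(** Squaring [half_gap_bound] on both sides of [l k] and cancelling the terms in [rnorm x ^+ 2]. In
    spectral terms, [s^2 - d s] and [s^2 + d s] are nonnegative because the spectrum of
    [s = A - l k] avoids the punctured interval of radius [d]. *)
Lemma shifted_form_bound k x : dom A x ->
  d * `|complex.Re (ip (s k x) x)| <= rnorm (s k x) ^+ 2.
Proof.
have d_gt0 := d0.
move=> Ax; have h sg (sgE : sg = 1 \/ sg = -1) :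
    sg * (d * complex.Re (ip (s k x) x)) <= rnorm (s k x) ^+ 2.
  have := @half_gap_bound k sg x sgE Ax.
  rewrite rmorphD/= scalerDl opprD addrA -/(s k x) => hh.
  have : (d / 2 * rnorm x) ^+ 2 <= rnorm (s k x - (sg * (d / 2))%:C%C *: x) ^+ 2.
    by apply: lerXn2r; rewrite ?nnegrE ?rnorm_ge0 ?mulr_ge0 ?rnorm_ge0// ?divr_ge0// ltW.
  rewrite (sqr_rnormB hip) ipZr conjc_realE ReZ rnormZ modulus_real !exprMn.
  rewrite real_normK ?num_real// exprMn.
  have -> : sg ^+ 2 = 1 by case: sgE => ->; rewrite ?sqrrN expr1n.
  lra.
have h1 := h 1 (or_introl erefl); have h2 := h (-1) (or_intror erefl).
case: (ger0P (complex.Re (ip (s k x) x))) => _; lra.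
Qed.

(** The best [t] would be [Y / X]; both numbers are enlarged by [eta] because either may vanish. *)
Lemma geometric_mean_bound (P X Y : R) : 0 <= X -> 0 <= Y ->
  (forall t, 0 < t -> P *+ 2 <= t * X ^+ 2 + Y ^+ 2 / t) -> P <= X * Y.
Proof.
move=> X0 Y0 h; apply/ler_addgt0Pr => ep ep0.
pose t := (Y + ep / (2 * (X + Y + 1))) .
have ee : 0 < ep / (2 * (X + Y + 1)) by rewrite divr_gt0// mulr_gt0//; lra.
set eta := ep / _ in t ee.
have et : eta * (X + Y + 1) = ep / 2 by rewrite /eta; field; lra.
pose u := X + eta; have t0 : 0 < t by rewrite /t; lra.
have u0 : 0 < u by rewrite /u; lra.
have e0 : 0 < eta by [].
have h1 := h (t / u) (divr_gt0 t0 u0).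
have h2 : t / u * X ^+ 2 <= t * X.
  rewrite -mulrA ler_pM2l// mulrC ler_pdivrMr// expr2 ler_wpM2l// /u; lra.
have h3 : Y ^+ 2 / (t / u) <= Y * u.
  rewrite invf_div mulrA ler_pdivrMr// [leRHS]mulrAC ler_pM2r// expr2 ler_wpM2l// /t; lra.
have : P *+ 2 <= t * X + Y * u by lra.
rewrite /t /u; nra.
Qed.

(** Polarization of [shifted_form_bound] with [x + y] and [x - y]. Scaling [x] by the root of [t]
    and [y] by its inverse leaves the left side unchanged, and optimizing over [t] turns the sum of
    squares into a product. *)
Lemma shifted_form_bound2 k x y : dom A x -> dom A y ->
  d * complex.Re (ip (s k x) y) <= rnorm (s k x) * rnorm (s k y).
Proof.
have d_gt0 := d0.
have sD a b : dom A a -> dom A b -> s k (a + b) = s k a + s k b.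
  by move=> Aa Ab; rewrite /s opD// scalerDr opprD addrACA.
have sB a b : dom A a -> dom A b -> s k (a - b) = s k a - s k b.
  move=> Aa Ab; rewrite /s opB// scalerBr !opprB [_ *: b - _]addrC addrACA.
  by rewrite [- A b + _]addrC.
have h0 a b : dom A a -> dom A b ->
    d * complex.Re (ip (s k a) b) *+ 2 <= rnorm (s k a) ^+ 2 + rnorm (s k b) ^+ 2.
  move=> Aa Ab; have h1 := shifted_form_bound k (op_domD Aa Ab).
  have h2 := shifted_form_bound k (op_domB Aa Ab).
  have := parallelogram hip (s k a) (s k b); rewrite -sD// -sB// => p.
  move: h1 h2 p (shifted_symmetric k Ab Aa); rewrite {1}sD// {1}sB//.
  move: (s k a) (s k b) (rnorm (s k (a + b))) (rnorm (s k (a - b))) => u v n1 n2.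
  rewrite !(ipBl, ipBr, ipDl, ipDr) => h1 h2 p sym; move: h1 h2; rewrite sym.
  rewrite !(ReD, ReN) (ReipC u b); set q := complex.Re (ip u b).
  set X := complex.Re (ip u a); set Y := complex.Re (ip v b).
  move=> h1 h2.
  have := ler_norm (X + q + (q + Y)).
  have := ler_norm (- (X - q - (q - Y))); rewrite normrN => m1 m2.
  have g1 : d * (X + q + (q + Y)) <= n1 ^+ 2.
    by apply: le_trans h1; rewrite ler_pM2l.
  have g2 : d * (- (X - q - (q - Y))) <= n2 ^+ 2.
    by apply: le_trans h2; rewrite ler_pM2l.
  lra.
move=> Ax Ay; apply: geometric_mean_bound; rewrite ?rnorm_ge0// => t t0.
have r0 : 0 < Num.sqrt t by rewrite sqrtr_gt0.
have tE : Num.sqrt t ^+ 2 = t by rewrite sqr_sqrtr// ltW.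
have := h0 ((Num.sqrt t)%:C%C *: x) (((Num.sqrt t)^-1)%:C%C *: y) (op_domZ _ Ax) (op_domZ _ Ay).
have sZ a b : dom A b -> s k (a *: b) = a *: s k b.
  by move=> Ab; rewrite /s opZ// scalerBr !scalerA mulrC.
rewrite !sZ// !rnormZ !modulus_real !exprMn !real_normK ?num_real// exprVn tE.
rewrite ipZl ipZr conjc_realE !ReZ [_ * (_ * complex.Re _)]mulrA divff ?gt_eqF// mul1r.
by rewrite [t^-1 * _]mulrC.
Qed.

(** Vectors orthogonal to the range of [A - l k] are eigenvectors by self-adjointness, hence
    multiples of [e k]; so [x] is a limit of vectors [s k y]. Replacing [s k y] by [x] in
    [shifted_form_bound2] and dividing by [rnorm x] gives the bound. *)
Lemma off_eigenspace_bound k x : dom A x -> ip x (e k) = 0 ->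
  d * rnorm x <= rnorm (s k x).
Proof.
have d_gt0 := d0.
move=> Ax xe; pose V := [set s k y | y in dom A].
have Vs : linear_subspace V.
  split; first by exists 0; [exact: dom0|rewrite /s op0 scaler0 subr0].
  move=> a _ _ [y1 Ay1 <-] [y2 Ay2 <-]; exists (a *: y1 + y2); first exact: domP.
  by rewrite /s opP// scalerDr opprD addrACA scalerBr !scalerA mulrC.
have appr := @approx_of_orthogonal R H ip hip V x Vs.
have {}appr : forall ep : R, 0 < ep -> exists2 u, V u & rnorm (x - u) < ep.
  apply: appr => v vV.
  have [_ /(_ v ((l k)%:C%C *: v))[h _]] := hA.
  have [|Av Avv] := h.
    move=> y Ay; rewrite ipZr conjc_realE -ipZl; apply/eqP.
    rewrite -subr_eq0 -ipBl -/(s k y); apply/eqP/ip_eq0C/vV.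
    by exists y.
  rewrite (kerA Av Avv) ipZl; have -> : ip (e k) x = 0 by exact: ip_eq0C.
  by rewrite mulr0.
rewrite mulrC -ler_pdivlMr//.
have p0 : 0 <= rnorm (s k x) / d by rewrite divr_ge0 ?rnorm_ge0 ?ltW.
have [->|xn0] := eqVneq x 0; first by rewrite rnorm0 divr_ge0 ?rnorm_ge0 ?ltW.
have x0 : 0 < rnorm x by rewrite rnorm_gt0.
rewrite ler_pdivlMr//.
suff : rnorm x * (d * rnorm x) <= rnorm x * rnorm (s k x).
  by rewrite ler_pM2l// mulrC.
apply/ler_addgt0Pr => ep ep0.
(* [K] bounds the factor of [rnorm r] in the total error made by replacing [s k y] with [x]. *)
pose K := d * rnorm x + rnorm (s k x) + 1.
have K0 : 0 < K by rewrite /K; have := rnorm_ge0 (s k x); nra.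
have [_ [y Ay <-]] := appr (ep / K) (divr_gt0 ep0 K0).
set r := x - s k y => rK.
have := shifted_form_bound2 k Ay Ax.
have -> : s k y = x - r by rewrite /r subKr.
rewrite ipBl (ipxx hip) ReD ReN/= => h.
have h1 := Re_ip_le hip r x.
have h2 : rnorm (x - r) <= rnorm x + rnorm r by rewrite -(rnormN r) ler_rnormD.
have h3 : rnorm (x - r) * rnorm (s k x) <= (rnorm x + rnorm r) * rnorm (s k x).
  by rewrite ler_wpM2r ?rnorm_ge0.
have h4 : d * complex.Re (ip r x) <= d * (rnorm r * rnorm x) by rewrite ler_pM2l.
have h5 : rnorm r * K <= ep by rewrite -ler_pdivlMr// ltW.
have r0 := rnorm_ge0 r.
rewrite /K in h5; lra.
Qed.

Lemma eigenvectors_total x : (forall k, ip x (e k) = 0) -> x = 0.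
Proof.
have d_gt0 := d0.
move=> xe; apply/eqP/negPn/negP => xn0.
pose V := [set y | forall k, ip y (e k) = 0].
have Vs : linear_subspace V.
  split=> [k|a y1 y2 h1 h2 k]; first by rewrite ip0l.
  by rewrite ipDl ipZl h1 h2 mulr0 addr0.
(* A real point of the resolvent set. On the invariant orthocomplement [V] the operator is bounded
   below at every real number, which leaves no room for the approximate eigenvalues of its
   resolvent. *)
pose t := l 0 + d / 2.
have tk : `|t - l 0| = d / 2 by rewrite /t addrC addKr gtr0_norm// divr_gt0.
have tl : forall j, t != l j by apply: (@near_eigenvalue_gap 0); rewrite tk; lra.
have [S [cS AS SA]] := resA tl.
have VS y : V y -> V (S y).
  move=> Vy k; have [Ae _ Aek] := eA k; have [AS1 AS2] := AS y.
  have := Vy k; rewrite -{1}AS2 ipBl ipZl (op_symmetric hA)// Aek ipZr conjc_realE.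
  rewrite -mulrBl => /eqP; rewrite mulf_eq0 -rmorphB/= => /orP[|/eqP//].
  by rewrite (inj_eq (@complexI R) _ 0) subr_eq0 eq_sym (negPf (tl k)).
have [|N [N0 _]] := resolvent_norm_attained hip hA cS AS Vs VS; first by exists x.
suff nb u : bounded_below_on A V u by case.
have [[k uk]|nu] := pselect (exists k, u = l k).
  by exists d => // y Vy Ay; rewrite uk; apply: off_eigenspace_bound.
have ul k : u != l k by apply/eqP => uk; apply: nu; exists k.
have [c c0 cP] := resolvent_bounded_below (resA ul).
by exists c => // y _; exact: cP.
Qed.

Lemma eigenvectors_orthogonal j k : j != k -> ip (e j) (e k) = 0.
Proof.
move=> jk; have [Aj _ Ej] := eA j; have [Ak _ Ek] := eA k.
have := op_symmetric hA Aj Ak; rewrite Ej Ek ipZl ipZr conjc_realE => /eqP.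
rewrite -subr_eq0 -mulrBl mulf_eq0 -rmorphB/= => /orP[|/eqP//].
rewrite (inj_eq (@complexI R) _ 0) => /eqP lE.
by have := sep jk; rewrite lE normr0 leNgt d0.
Qed.

End Completeness.

(** * Expansion in an orthonormal basis *)

Lemma bounded_sums_cauchy (R : realType) (c : nat -> R) (M : R) :
  (forall k, 0 <= c k) -> (forall n, \sum_(0 <= k < n) c k <= M) ->
  forall ep : R, 0 < ep ->
    exists N, forall m n, (N <= m)%N -> (m <= n)%N -> \sum_(m <= k < n) c k < ep.
Proof.
move=> c0 cM ep ep0; pose S := range (fun n => \sum_(0 <= k < n) c k).
have Ssup : has_sup S.
  by split; [exists (\sum_(0 <= k < 0) c k), 0%N|exists M => _ [n _ <-]].
have [_ [N _ <-] NP] := sup_adherent ep0 Ssup.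
exists N => m n Nm mn.
have h : \sum_(0 <= k < n) c k <= sup S by apply: ub_le_sup; [case: Ssup|exists n].
rewrite (@big_cat_nat _ _ _ m)//= (@big_cat_nat _ _ _ N 0 m)//= in h.
have : 0 <= \sum_(N <= k < m) c k by apply: sumr_ge0.
lra.
Qed.

Section Coordinates.
Context (R : realType) (H : completeNormedModType R[i]).
Context (ip : {dot H for Num.conj}) (hip : norm_from_dot ip).
Context (e : nat -> H) (e1 : forall k, rnorm (e k) = 1).
Context (eo : forall j k, j != k -> ip (e j) (e k) = 0).
Context (et : forall x, (forall k, ip x (e k) = 0) -> x = 0).

Lemma ip_basis j k : ip (e j) (e k) = (j == k)%:R.
Proof. by have [->|/eo//] := eqVneq; rewrite (ipxx hip) e1 expr1n. Qed.

Lemma eq_from_coords x y : (forall k, ip x (e k) = ip y (e k)) -> x = y.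
Proof. by move=> xy; apply/eqP; rewrite -subr_eq0; apply/eqP/et => k; rewrite ipBl xy subrr. Qed.

Lemma coord_sum (c : nat -> R[i]) m n j :
  ip (\sum_(m <= k < n) c k *: e k) (e j) = if (m <= j < n)%N then c j else 0.
Proof.
rewrite ip_suml; case: ifP => jmn.
  rewrite (bigD1_seq j) ?mem_index_iota ?iota_uniq//= ipZl ip_basis eqxx mulr1.
  by rewrite big1 ?addr0// => k kj; rewrite ipZl eo ?mulr0.
rewrite big_nat_cond big1// => k; rewrite andbT => kmn; rewrite ipZl eo ?mulr0//.
by apply: contraFneq jmn => <-.
Qed.

Lemma sqr_rnorm_sum (c : nat -> R[i]) m n :
  rnorm (\sum_(m <= k < n) c k *: e k) ^+ 2 = \sum_(m <= k < n) modulus (c k) ^+ 2.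
Proof.
apply: (@complexI R); rewrite -(ipxx hip) {1}ip_suml rmorph_sum/=.
rewrite big_nat_cond [RHS]big_nat_cond; apply: eq_bigr => k; rewrite andbT => kmn.
by rewrite ipZl ipC coord_sum kmn mulcJ.
Qed.

Lemma bessel x n : \sum_(0 <= k < n) modulus (ip x (e k)) ^+ 2 <= rnorm x ^+ 2.
Proof.
pose y := \sum_(0 <= k < n) ip x (e k) *: e k.
have yy : ip (x - y) y = 0.
  rewrite ipC {2}/y ip_suml big_nat_cond big1 ?rmorph0// => k; rewrite andbT => kn.
  by rewrite ipZl [ip (e k) _]ipC ipBl /y coord_sum kn subrr rmorph0 mulr0.
by rewrite -sqr_rnorm_sum -/y -[x in leRHS](subrK y) (pythagoras hip)// lerDr sqr_ge0.
Qed.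

Lemma riesz_fischer (c : nat -> R[i]) (M : R) :
  (forall n, \sum_(0 <= k < n) modulus (c k) ^+ 2 <= M) ->
  exists2 x, forall k, ip x (e k) = c k & rnorm x ^+ 2 <= M /\
    forall ep : R, 0 < ep -> exists N, forall n, (N <= n)%N ->
      rnorm (x - \sum_(0 <= k < n) c k *: e k) < ep.
Proof.
move=> cM; pose u n := \sum_(0 <= k < n) c k *: e k.
have c0 k : 0 <= modulus (c k) ^+ 2 by exact: sqr_ge0.
have du m n : (m <= n)%N -> u n - u m = \sum_(m <= k < n) c k *: e k.
  by move=> mn; rewrite /u (@big_cat_nat _ _ _ m)//= [X in X - _]addrC addrK.
have cu : forall ep : R, 0 < ep ->
    exists N, forall m n, (N <= m)%N -> (N <= n)%N -> rnorm (u m - u n) < ep.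
  move=> ep ep0; have [N NP] := bounded_sums_cauchy c0 cM (exprn_gt0 2 ep0).
  exists N => m n; wlog mn : m n / (m <= n)%N => [hw Nm Nn|Nm _].
    by case/orP: (leq_total m n) => ?; [|rewrite rnormBC]; exact: hw.
  rewrite rnormBC -(@ltr_pXn2r _ 2) ?nnegrE ?rnorm_ge0 ?(ltW ep0)//.
  by rewrite du// sqr_rnorm_sum NP.
have [x xP] := cauchy_complete cu.
have xP' ep : 0 < ep -> exists N, forall n, (N <= n)%N -> rnorm (x - u n) < ep.
  by move=> /xP[N NP]; exists N => n Nn; rewrite rnormBC NP.
exists x; last split=> //.
  move=> k; apply/eqP; rewrite -subr_eq0 -modulus_eq0 eq_le modulus_ge0 andbT.
  apply/ler_addgt0Pr => ep ep0; rewrite add0r; have [N NP] := xP' _ ep0.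
  have -> : c k = ip (u (maxn N k.+1)) (e k).
    by rewrite /u coord_sum leq0n leq_max leqnn orbT.
  rewrite -ipBl (le_trans (modulus_ip_le hip _ _))// e1 mulr1 ltW// NP//.
  exact: leq_maxl.
rewrite -[M]sqr_sqrtr; last by rewrite (le_trans _ (cM 0%N))// big_geq.
apply: lerXn2r; rewrite ?nnegrE ?rnorm_ge0 ?sqrtr_ge0//.
apply/ler_addgt0Pr => ep ep0; have [N NP] := xP' _ ep0.
have h1 : rnorm (u N) <= Num.sqrt M.
  by rewrite -(ger0_norm (rnorm_ge0 _)) -sqrtr_sqr ler_wsqrtr// sqr_rnorm_sum.
have := ler_rnormD (x - u N) (u N); rewrite subrK; have := NP N (leqnn _); lra.
Qed.

Lemma expansion x (ep : R) : 0 < ep -> exists N, forall n, (N <= n)%N ->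
  rnorm (x - \sum_(0 <= k < n) ip x (e k) *: e k) < ep.
Proof.
move=> ep0; have [y yx [_ yP]] := riesz_fischer (bessel x).
by move: yP; rewrite (eq_from_coords yx); apply.
Qed.

Lemma rnorm_le_sums x (M : R) :
  (forall n, \sum_(0 <= k < n) modulus (ip x (e k)) ^+ 2 <= M) -> rnorm x ^+ 2 <= M.
Proof. by move=> /riesz_fischer[y yx [yM _]]; rewrite -(eq_from_coords yx). Qed.

Lemma rnorm_le_coords (b : R) x y : 0 <= b ->
  (forall k, modulus (ip y (e k)) <= b * modulus (ip x (e k))) ->
  rnorm y <= b * rnorm x.
Proof.
move=> b0 h; rewrite -(@ler_pXn2r _ 2) ?nnegrE ?mulr_ge0 ?rnorm_ge0//.
apply: rnorm_le_sums => n; apply: (@le_trans _ _ (b ^+ 2 * \sum_(0 <= k < n) modulus (ip x (e k)) ^+ 2)).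
  rewrite mulr_sumr; apply: ler_sum => k _; rewrite -exprMn.
  by apply: lerXn2r; rewrite ?nnegrE ?mulr_ge0 ?modulus_ge0.
by rewrite exprMn ler_wpM2l ?sqr_ge0// bessel.
Qed.

Lemma ip_partial_sums x y (ep : R) : 0 < ep -> exists N, forall n, (N <= n)%N ->
  modulus (ip x y - \sum_(0 <= k < n) ip x (e k) * (ip y (e k))^*) <= ep.
Proof.
move=> ep0; have y0 := rnorm_ge0 y.
have p0 : 0 < ep / (rnorm y + 1) by rewrite divr_gt0// ltr_wpDl.
have [N NP] := expansion x p0; exists N => n Nn; have := NP n Nn.
rewrite ltr_pdivlMr ?ltr_wpDl// => h.
under eq_bigr do rewrite -ipC -ipZl; rewrite -ip_suml -ipBl.
apply: le_trans (modulus_ip_le hip _ _) _.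
have := rnorm_ge0 (x - \sum_(0 <= k < n) ip x (e k) *: e k); lra.
Qed.

(** Parseval's identity in a form that lets a factor such as [l k] move from one argument to the
    other, coordinate by coordinate. *)
Lemma ip_eq_coords x y x' y' :
  (forall k, ip x (e k) * (ip y (e k))^* = ip x' (e k) * (ip y' (e k))^*) ->
  ip x y = ip x' y'.
Proof.
move=> h; apply/eqP; rewrite -subr_eq0 -modulus_eq0 eq_le modulus_ge0 andbT.
apply/ler_addgt0Pr => ep ep0; rewrite add0r.
have p : 0 < ep / 2 by rewrite divr_gt0.
have [N1 N1P] := ip_partial_sums x y p; have [N2 N2P] := ip_partial_sums x' y' p.
pose n := maxn N1 N2; have := N1P n (leq_maxl _ _); have := N2P n (leq_maxr _ _).
under eq_bigr do rewrite -h.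
set S := \sum_(_ <= _ < _) _ => h1 h2.
have := ler_modulusD (ip x y - S) (S - ip x' y'); rewrite subrKA.
rewrite [modulus (S - _)]modulusBC; lra.
Qed.

(** The diagonal operator with symbol [b], as a total function. The default [0] arises only if no
    vector has the required coordinates; [coord_diag] excludes this for bounded [b]. *)
Definition diag (b : nat -> R[i]) (x : H) : H :=
  xget 0 [set y | forall k, ip y (e k) = b k * ip x (e k)].

Lemma coord_diag b (M : R) x k : (forall k, modulus (b k) <= M) ->
  ip (diag b x) (e k) = b k * ip x (e k).
Proof.
move=> bM; rewrite /diag; case: xgetP => [y _ -> //|/(_ _)h]; exfalso.
have M0 : 0 <= M by rewrite (le_trans (modulus_ge0 _) (bM 0%N)).
have [|y yE _] := @riesz_fischer (fun k => b k * ip x (e k)) (M ^+ 2 * rnorm x ^+ 2).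
  move=> n; apply: (@le_trans _ _ (M ^+ 2 * \sum_(0 <= k < n) modulus (ip x (e k)) ^+ 2)).
    rewrite mulr_sumr; apply: ler_sum => j _; rewrite modulusM exprMn.
    by rewrite ler_wpM2r ?sqr_ge0// lerXn2r ?nnegrE ?modulus_ge0.
  by rewrite ler_wpM2l ?sqr_ge0// bessel.
exact: (h y).
Qed.

Lemma rnorm_diag b (M : R) x : (forall k, modulus (b k) <= M) ->
  rnorm (diag b x) <= M * rnorm x.
Proof.
move=> bM; apply: rnorm_le_coords; first exact: le_trans (modulus_ge0 _) (bM 0%N).
move=> k; rewrite (coord_diag _ _ bM) modulusM ler_wpM2r ?modulus_ge0//.
Qed.

Context (A : operator H) (hA : self_adjoint ip A) (l : nat -> R).
Context (eA : forall k, dom A (e k) /\ A (e k) = (l k)%:C%C *: e k).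

Lemma coord_op x k : dom A x -> ip (A x) (e k) = (l k)%:C%C * ip x (e k).
Proof.
by have [Ae Aek] := eA k; move=> Ax; rewrite (op_symmetric hA)// Aek ipZr conjc_realE.
Qed.

(** Such a [w] is the image of [x] under the adjoint, by Parseval; self-adjointness then yields
    membership in the domain. This is how the eigenvectors built from coordinates get into
    [dom A]. *)
Lemma dom_from_coords x w : (forall k, ip w (e k) = (l k)%:C%C * ip x (e k)) ->
  dom A x /\ A x = w.
Proof.
move=> wx; have [_ /(_ x w)[h _]] := hA; apply: h => y Ay.
apply: ip_eq_coords => k; rewrite coord_op// wx rmorphM/= conjc_realE.
by rewrite mulrCA mulrA.
Qed.

End Coordinates.

(** * Eigenvectors of the adjoint perturbation far out *)

(** A half-open interval of length [d] contains at most one of the [l j], so any bounded interval is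
    left for good after finitely many indices. *)
Lemma separated_unbounded (R : realType) (l : nat -> R) (d : R) : 0 < d ->
  (forall j k, j != k -> d <= `|l j - l k|) ->
  forall M : R, exists N, forall n, (N <= n)%N -> M <= `|l n|.
Proof.
move=> d0 sep M.
have step (a : R) (m : nat) : exists N, forall n, (N <= n)%N -> ~ (a <= l n < a + m%:R * d).
  elim: m => [|m [N NP]].
    by exists 0%N => n _; rewrite mul0r addr0 => /andP[h1 h2]; lra.
  have [[j /andP[j1 j2]]|nj] := pselect (exists j, a + m%:R * d <= l j < a + m.+1%:R * d).
    exists (maxn N j.+1) => n; rewrite geq_max => /andP[Nn jn] /andP[n1 n2].
    have [nm|nm] := ltP (l n) (a + m%:R * d); first by apply: (NP n Nn); rewrite n1.
    have := sep n j ltac:(by rewrite gt_eqF).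
    move: j2 n2; rewrite -natr1 mulrDl mul1r; case: (ger0P (l n - l j)) => _ j2 n2; lra.
  exists N => n Nn /andP[n1 n2].
  have [nm|nm] := ltP (l n) (a + m%:R * d); first by apply: (NP n Nn); rewrite n1.
  by apply: nj; exists n; rewrite nm.
(* Chosen so that [m.+1] intervals of length [d] starting at [- |M|] reach beyond [|M|]. *)
pose m := Num.trunc (`|M| / d * 2 + 1).
have [N NP] := step (- `|M|) m.+1; exists N => n Nn; rewrite leNgt; apply/negP => h.
apply: (NP n Nn).
have mP : `|M| / d * 2 + 1 < m.+1%:R by apply: truncnS_gt.
have : (`|M| / d * 2 + 1) * d < m.+1%:R * d by rewrite ltr_pM2r.
have -> : (`|M| / d * 2 + 1) * d = `|M| * 2 + d by field; lra.
move=> hm; have := ler_norm M; have := ler_norm (l n).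
have := ler_norm (- l n); rewrite normrN => h1 h2 h3.
by apply/andP; split; lra.
Qed.

Section Tail.
Context (R : realType) (H : completeNormedModType R[i]).
Context (ip : {dot H for Num.conj}) (hip : norm_from_dot ip).
Context (e : nat -> H) (e1 : forall k, rnorm (e k) = 1).
Context (eo : forall j k, j != k -> ip (e j) (e k) = 0).
Context (et : forall x, (forall k, ip x (e k) = 0) -> x = 0).
Context (A : operator H) (hA : self_adjoint ip A) (l : nat -> R).
Context (eA : forall k, dom A (e k) /\ A (e k) = (l k)%:C%C *: e k).
Context (d : R) (d0 : 0 < d) (sep : forall j k, j != k -> d <= `|l j - l k|).
Context (phi psi : H).

Lemma coords_small x (ep : R) : 0 < ep ->
  exists N, forall n, (N <= n)%N -> modulus (ip x (e n)) < ep.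
Proof.
move=> ep0.
have [N NP] := bounded_sums_cauchy (fun k => sqr_ge0 _) (bessel hip e1 eo x) (exprn_gt0 2 ep0).
exists N => n Nn; have := NP n n.+1 Nn (leqnSn _).
by rewrite big_nat1 ltr_pXn2r// ?nnegrE ?modulus_ge0// ltW.
Qed.

(** The scalars are embedded isometrically as the line spanned by [e 0], so that
    [contraction_fixpoint] applies. *)
Lemma complex_fixpoint (F : R[i] -> R[i]) (z0 : R[i]) (r q : R) :
  0 <= q -> q < 1 -> 0 <= r ->
  (forall z, modulus (z - z0) <= r -> modulus (F z - z0) <= r) ->
  (forall z w, modulus (z - z0) <= r -> modulus (w - z0) <= r ->
    modulus (F z - F w) <= q * modulus (z - w)) ->
  exists2 z, modulus (z - z0) <= r & F z = z.
Proof.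
move=> q0 q1 r0 Fr Fq.
have nE (z w : R[i]) : rnorm (z *: e 0 - w *: e 0) = modulus (z - w).
  by rewrite -scalerBl rnormZ e1 mulr1.
have ce (z : R[i]) : ip (z *: e 0) (e 0) = z by rewrite ipZl (ip_basis hip)// mulr1.
have cl x y : modulus (ip x (e 0) - ip y (e 0)) <= rnorm (x - y).
  by rewrite -ipBl (le_trans (modulus_ip_le hip _ _))// e1 mulr1.
have cr x : rnorm (x - z0 *: e 0) <= r -> modulus (ip x (e 0) - z0) <= r.
  by move=> h; rewrite -{1}(ce z0) (le_trans (cl _ _)).
have [||x xr xF] := @contraction_fixpoint R H (fun x => F (ip x (e 0)) *: e 0) (z0 *: e 0) r q q0 q1 r0.
- by move=> x xr; rewrite nE; apply/Fr/cr.
- move=> x y xr yr; rewrite nE (le_trans (Fq _ _ (cr _ xr) (cr _ yr)))//.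
  by rewrite ler_wpM2l// cl.
by exists (ip x (e 0)); [exact: cr|rewrite -{2}xF ce].
Qed.

(* Symbol of the reduced resolvent of [A] at a point near [l n]. *)
Definition reduced (n : nat) (v : R[i]) (k : nat) : R[i] :=
  if k == n then 0 else ((l k)%:C%C - v)^-1.

Lemma dist_ge n v k : modulus (v - (l n)%:C%C) <= d / 4 -> k != n ->
  d / 2 <= modulus ((l k)%:C%C - v).
Proof.
have d_gt0 := d0.
move=> vn kn; have := sep kn; rewrite -modulus_real rmorphB/= => h.
have := ler_modulusD ((l k)%:C%C - v) (v - (l n)%:C%C); rewrite subrKA; lra.
Qed.

Lemma reduced_le n v : modulus (v - (l n)%:C%C) <= d / 4 ->
  forall k, modulus (reduced n v k) <= 2 / d.
Proof.
move=> vn k; rewrite /reduced; case: eqP => [_|/eqP kn].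
  by rewrite modulus0 divr_ge0// ltW.
have h := dist_ge vn kn; have d20 : 0 < d / 2 by rewrite divr_gt0.
by rewrite modulusV -invf_div lef_pV2 ?posrE// (lt_le_trans d20).
Qed.

Lemma reduced_lip n v w : modulus (v - (l n)%:C%C) <= d / 4 ->
  modulus (w - (l n)%:C%C) <= d / 4 ->
  forall k, modulus (reduced n v k - reduced n w k) <= (2 / d) ^+ 2 * modulus (v - w).
Proof.
move=> vn wn k; have := reduced_le vn k; have := reduced_le wn k.
rewrite /reduced; case: eqP => [_ _ _|/eqP kn].
  by rewrite subrr modulus0 mulr_ge0 ?sqr_ge0 ?modulus_ge0.
have d20 : 0 < d / 2 by rewrite divr_gt0.
have h1 := lt_le_trans d20 (dist_ge vn kn); have h2 := lt_le_trans d20 (dist_ge wn kn).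
rewrite modulus_gt0 in h1; rewrite modulus_gt0 in h2.
have -> : ((l k)%:C%C - v)^-1 - ((l k)%:C%C - w)^-1 =
    ((l k)%:C%C - v)^-1 * ((l k)%:C%C - w)^-1 * (v - w).
  by field; rewrite h1 h2.
move=> hw hv; rewrite 2!modulusM ler_wpM2r ?modulus_ge0// expr2.
by apply: ler_pM => //; exact: modulus_ge0.
Qed.

(** [1 + g n v] is the perturbation determinant of the rank-one term with the [n]-th mode
    removed. *)
Let g n v := ip (diag ip e (reduced n v) phi) psi.

Lemma g_lip n v w : modulus (v - (l n)%:C%C) <= d / 4 ->
  modulus (w - (l n)%:C%C) <= d / 4 ->
  modulus (g n v - g n w) <= (2 / d) ^+ 2 * rnorm phi * rnorm psi * modulus (v - w).
Proof.
move=> vn wn; rewrite /g -ipBl (le_trans (modulus_ip_le hip _ _))//.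
rewrite mulrAC ler_wpM2r ?rnorm_ge0// mulrAC.
apply: (rnorm_le_coords hip e1 eo et); first by rewrite mulr_ge0 ?sqr_ge0 ?modulus_ge0.
move=> k; rewrite ipBl !(coord_diag hip e1 eo _ _ (reduced_le _)) //.
by rewrite -mulrBl modulusM ler_wpM2r ?modulus_ge0// reduced_lip.
Qed.

(** Split [phi] into a finite section [ph] and a small remainder. On [ph] the reduced resolvent is
    small because [l n] moves away from the finitely many [l k] involved; on the remainder the
    uniform bound [2 / d] suffices. Each part contributes at most [1/4]. *)
Lemma g_small : exists n0, forall n v, (n0 <= n)%N ->
  modulus (v - (l n)%:C%C) <= d / 4 -> modulus (g n v) <= 1 / 2.
Proof.
have d_gt0 := d0; have ph0 := rnorm_ge0 phi; have ps0 := rnorm_ge0 psi.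
have ep0 : 0 < d / (8 * (rnorm psi + 1)) by rewrite divr_gt0// mulr_gt0//; lra.
have [N /(_ N (leqnn _))NP] := expansion hip e1 eo et phi ep0.
set ph := \sum_(0 <= k < N) _ in NP.
pose L := 4 * (rnorm phi * rnorm psi + 1).
have L0 : 0 < L by rewrite /L; nra.
have [n0 n0P] := separated_unbounded d0 sep (L + d / 4 + \sum_(0 <= k < N) `|l k|).
exists n0 => n v n0n vn; rewrite /g.
have vb := reduced_le vn; have cE := coord_diag hip e1 eo _ _ vb.
have -> : diag ip e (reduced n v) phi =
    diag ip e (reduced n v) ph + diag ip e (reduced n v) (phi - ph).
  by apply: (eq_from_coords et) => k; rewrite ipDl !cE -mulrDr -ipDl addrC subrK.
rewrite ipDl (le_trans (ler_modulusD _ _))//.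
have h1 := modulus_ip_le hip (diag ip e (reduced n v) ph) psi.
have h2 := modulus_ip_le hip (diag ip e (reduced n v) (phi - ph)) psi.
have h3 := rnorm_diag hip e1 eo et (phi - ph) vb.
have h4 : rnorm (diag ip e (reduced n v) ph) <= L^-1 * rnorm phi.
  apply: (rnorm_le_coords hip e1 eo et); first by rewrite invr_ge0 ltW.
  move=> k; rewrite cE /ph (coord_sum hip e1 eo)/=; case: ifP => kN; last first.
    by rewrite mulr0 modulus0 mulr_ge0 ?invr_ge0 ?modulus_ge0// ltW.
  rewrite modulusM ler_wpM2r ?modulus_ge0// /reduced; case: eqP => _.
    by rewrite modulus0 invr_ge0 ltW.
  have lk : `|l k| <= \sum_(0 <= k < N) `|l k|.
    rewrite (bigD1_seq k) ?mem_index_iota ?iota_uniq//= lerDl.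
    by apply: sumr_ge0.
  rewrite modulusV lef_pV2 ?posrE//.
    have := n0P n n0n; rewrite -(modulus_real (l n)) -(modulus_real (l k)) in lk *.
    have := ler_modulusD ((l k)%:C%C - v) (v - (l n)%:C%C); rewrite subrKA.
    have := ler_modulusB ((l n)%:C%C) ((l k)%:C%C).
    rewrite [modulus (_ - (l k)%:C%C)]modulusBC; lra.
  rewrite (lt_le_trans L0)//.
  have := n0P n n0n; rewrite -(modulus_real (l n)) -(modulus_real (l k)) in lk *.
  have := ler_modulusD ((l k)%:C%C - v) (v - (l n)%:C%C); rewrite subrKA.
  have := ler_modulusB ((l n)%:C%C) ((l k)%:C%C).
  rewrite [modulus (_ - (l k)%:C%C)]modulusBC; lra.
have q1 : modulus (ip (diag ip e (reduced n v) ph) psi) <= 1 / 4.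
  apply: le_trans h1 _; apply: le_trans (ler_wpM2r ps0 h4) _.
  by rewrite -mulrA mulrC ler_pdivrMr// /L; lra.
have q2 : modulus (ip (diag ip e (reduced n v) (phi - ph)) psi) <= 1 / 4.
  apply: le_trans h2 _; apply: le_trans (ler_wpM2r ps0 h3) _.
  have -> : 1 / 4 = 2 / d * (d / (8 * (rnorm psi + 1))) * (rnorm psi + 1).
    by field; lra.
  apply: ler_pM => //; last lra.
    by rewrite mulr_ge0 ?rnorm_ge0 ?divr_ge0 ?(ltW d_gt0).
  by rewrite ler_pM2l ?divr_gt0// ltW.
lra.
Qed.

(** Normalizing the [n]-th coordinate of [f n] to [1] reduces the eigenvalue equation to a scalar
    fixed point problem near [l n]. The bound on [f n - e n] by a coordinate of [psi] makes these
    distances square summable. *)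
Lemma tail_eigenvectors : exists (n0 : nat) (K : R) (f : nat -> H) (mu : nat -> R[i]),
  0 <= K /\ forall n, (n0 <= n)%N ->
  [/\ dom A (f n), A (f n) + ip (f n) psi *: phi = (mu n)^* *: f n,
      modulus (mu n - (l n)%:C%C) <= d / 4,
      modulus (mu n - (l n)%:C%C) <=
        2 * (modulus (ip phi (e n)) * modulus (ip psi (e n))) &
      rnorm (f n - e n) <= K * modulus (ip psi (e n))].
Proof.
have d_gt0 := d0; have ph0 := rnorm_ge0 phi; have ps0 := rnorm_ge0 psi.
have [n1 n1P] := g_small.
pose L := (2 / d) ^+ 2 * rnorm phi * rnorm psi.
have L0 : 0 <= L by apply: mulr_ge0 => //; apply: mulr_ge0 => //; exact: sqr_ge0.
(* [ab] below will be smaller than this minimum: [d / 8] makes [F] map the disc of radius [d / 4]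
   into itself, the other term makes it contract by [1/2]. The divisor accounts for
   [modulus qn <= rnorm psi]. *)
pose ep := Num.min (d / 8) (1 / (8 * (L + 1))) / (rnorm psi + 1).
have ep0 : 0 < ep.
  by apply: divr_gt0; [rewrite lt_min !divr_gt0// mulr_gt0//; lra|lra].
have [n2 n2P] := coords_small phi ep0.
pose K := 4 / d * rnorm phi.
have K0 : 0 <= K by rewrite mulr_ge0 ?divr_ge0 ?(ltW d_gt0).
suff h n : (maxn n1 n2 <= n)%N -> exists fm : H * R[i],
  [/\ dom A fm.1, A fm.1 + ip fm.1 psi *: phi = (fm.2)^* *: fm.1,
      modulus (fm.2 - (l n)%:C%C) <= d / 4,
      modulus (fm.2 - (l n)%:C%C) <=
        2 * (modulus (ip phi (e n)) * modulus (ip psi (e n))) &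
      rnorm (fm.1 - e n) <= K * modulus (ip psi (e n))].
  (* Choice needs a pair for every [n]; below the threshold it is a dummy. *)
  have /choice[fm fmP] : forall n, exists fm : H * R[i], (maxn n1 n2 <= n)%N ->
      [/\ dom A fm.1, A fm.1 + ip fm.1 psi *: phi = (fm.2)^* *: fm.1,
      modulus (fm.2 - (l n)%:C%C) <= d / 4,
      modulus (fm.2 - (l n)%:C%C) <=
        2 * (modulus (ip phi (e n)) * modulus (ip psi (e n))) &
      rnorm (fm.1 - e n) <= K * modulus (ip psi (e n))].
    move=> n; have [hn|hn] := boolP (maxn n1 n2 <= n)%N; last by exists (0, 0).
    by have [fm fmP] := h n hn; exists fm.
  by exists (maxn n1 n2), K, (fun n => (fm n).1), (fun n => (fm n).2); split.
rewrite geq_max => /andP[/n1P gP /n2P phn].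
set ln := (l n)%:C%C; set pn := ip phi (e n) in phn *.
pose qn := ip (e n) psi; have qnE : modulus (ip psi (e n)) = modulus qn.
  by rewrite ipC modulusJ.
pose ab := modulus pn * modulus qn.
have ab0 : 0 <= ab by rewrite mulr_ge0 ?modulus_ge0.
have abe : ab * (rnorm psi + 1) < Num.min (d / 8) (1 / (8 * (L + 1))) * (rnorm psi + 1).
  have q0 := modulus_ge0 qn; have p0 := modulus_ge0 pn.
  have : modulus qn <= rnorm psi by rewrite (le_trans (modulus_ip_le hip _ _))// e1 mul1r.
  move: phn; rewrite ltr_pdivlMr; last lra.
  set X := Num.min _ _; move=> h1 h2.
  have : modulus pn * modulus qn <= modulus pn * (rnorm psi + 1) by rewrite ler_wpM2l//; lra.
  rewrite /ab => h3; have h4 : modulus pn * modulus qn < X by lra.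
  by rewrite ltr_pM2r//; lra.
move: abe; rewrite ltr_pM2r; last lra.
rewrite lt_min => /andP[ab1]; rewrite ltr_pdivlMr; last lra.
move=> ab2.
have g1 v : modulus (v - ln) <= d / 4 -> 1 / 2 <= modulus (1 + g n v).
  move=> vn; have := gP v vn; have := ler_modulusB 1 (- g n v).
  rewrite modulus1 modulusN opprK; lra.
have g0 v : modulus (v - ln) <= d / 4 -> 1 + g n v != 0.
  by move=> vn; rewrite -modulus_gt0 (lt_le_trans _ (g1 v vn)).
have gV v : modulus (v - ln) <= d / 4 -> modulus (1 + g n v)^-1 <= 2.
  move=> vn; rewrite modulusV -[leRHS]invrK lef_pV2 ?posrE ?invr_gt0//.
    by have := g1 v vn; rewrite div1r.
  by rewrite modulus_gt0 g0.
(* For an eigenvector [e n - c D] with [c] its product with [psi], the [n]-th coordinate requires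
   [v = ln + c pn], and pairing with [psi] requires [c = qn - c g n v]. Eliminating [c] gives
   [v = F v]. *)
pose F v := ln + pn * qn / (1 + g n v).
have Fle v : modulus (v - ln) <= d / 4 -> modulus (F v - ln) <= 2 * ab.
  move=> vn; rewrite /F addrC addKr !modulusM mulrC; apply: ler_pM => //.
  - exact: modulus_ge0.
  - exact: gV.
have [|||||v vn vF] := @complex_fixpoint F ln (d / 4) (1 / 2).
- by [].
- lra.
- by rewrite divr_ge0// ltW.
- by move=> v vn; have := Fle v vn; lra.
- move=> v w vn wn.
  have -> : F v - F w = pn * qn * ((1 + g n v)^-1 * (1 + g n w)^-1) * (g n w - g n v).
    by rewrite /F; field; rewrite !g0.
  rewrite !modulusM -/ab.
  have := g_lip wn vn; rewrite -/L [modulus (w - v)]modulusBC => h.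
  have := gV v vn; have := gV w wn.
  have := modulus_ge0 (1 + g n v)^-1; have := modulus_ge0 (1 + g n w)^-1.
  have := modulus_ge0 (g n w - g n v); have := modulus_ge0 (v - w).
  move: h; set G := modulus (g n w - g n v); set M := modulus (v - w).
  set x := modulus _^-1; set y := modulus _^-1 => h M0 G0 y0 x0 y2 x2.
  have xy : x * y <= 4 by have := ler_pM x0 y0 x2 y2; lra.
  have h1 : ab * (x * y) * G <= ab * 4 * (L * M).
    apply: ler_pM => //; first by apply: mulr_ge0 => //; apply: mulr_ge0.
    by rewrite ler_wpM2l.
  have h2 : ab * 4 * L <= 1 / 2 by lra.
  have h3 : ab * 4 * L * M <= 1 / 2 * M by rewrite ler_wpM2r.
  lra.
set D := diag ip e (reduced n v) phi.
pose c := qn / (1 + g n v); pose f := e n - c *: D.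
have cE : ip f psi = c.
  rewrite /f ipBl ipZl -/(g n v) /c -/qn; field; exact: g0.
have vE : v = ln + c * pn by rewrite -{1}vF /F /c; field; exact: g0.
have Dk k : ip D (e k) = reduced n v k * ip phi (e k).
  exact: (coord_diag hip e1 eo _ _ (reduced_le vn)).
have fk k : ip f (e k) = (k == n)%:R - c * (reduced n v k * ip phi (e k)).
  by rewrite /f ipBl ipZl Dk (ip_basis hip e1 eo) eq_sym.
have [fA fE] : dom A f /\ A f = v *: f - c *: phi.
  apply: (dom_from_coords hip e1 eo et hA eA) => k.
  rewrite ipBl !ipZl fk /reduced; have [->|kn] := eqVneq k n.
    by rewrite -/pn vE /ln /=; ring.
  have : (l k)%:C%C - v != 0.
    by rewrite -modulus_gt0 (lt_le_trans _ (dist_ge vn kn))// divr_gt0.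
  by move=> lv /=; field.
(* The recorded number is the conjugate of the adjoint eigenvalue; as [l n] is real, its distance to
   [l n] is the same. *)
exists (f, v^*) => /=; rewrite conjCK; split=> //.
- by rewrite fE cE subrK.
- by rewrite -[ln]conjc_realE -rmorphB modulusJ.
- by rewrite -[ln]conjc_realE -rmorphB modulusJ qnE -vF; exact: Fle.
- rewrite /f addrC addKr rnormN rnormZ qnE /c modulusM.
  have hD := rnorm_diag hip e1 eo et phi (reduced_le vn).
  rewrite -/D in hD.
  have := gV v vn; have := modulus_ge0 qn; have := modulus_ge0 (1 + g n v)^-1.
  have := rnorm_ge0 D; rewrite /K.
  move: hD; set X := rnorm D; set Q := modulus qn; set y := modulus _^-1.
  move=> hD X0 y0 Q0 y2.
  have : y * X <= 2 * (2 / d * rnorm phi) by apply: ler_pM.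
  have -> : 4 / d * rnorm phi = 2 * (2 / d * rnorm phi) by field; lra.
  move=> h; rewrite -mulrA mulrC ler_wpM2r//.
Qed.

End Tail.

(** * Generalized eigenspaces of a matrix *)

Section GeneralizedEigenspaces.
Context (F : closedFieldType) (n : nat) (M : 'M[F]_n.+1).

(** The exponent can be lowered to the multiplicity [m] of [a] in the characteristic polynomial: by
    Cayley-Hamilton [v (M - a)^m] is killed by the cofactor [q] as well as by a power of [X - a],
    and these are coprime. *)
Lemma root_vector_geigenspace (a : F) (v : 'rV_n.+1) k :
  v *m (M - a%:M) ^+ k = 0 -> (v <= geigenspace M a)%MS.
Proof.
move=> vk; rewrite geigenspaceE; apply/sub_kermxP.
have [m [q + cE]] := multiplicity_XsubC (char_poly M) a.
have c0 : char_poly M != 0 by rewrite monic_neq0// char_poly_monic.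
rewrite c0/= => qa.
have q0 : q != 0 by apply: contraNneq c0 => q0; rewrite cE q0 mul0r.
have mn : (m <= n.+1)%N.
  have := size_char_poly M; rewrite cE size_mul ?expf_neq0 ?polyXsubC_eq0//.
  rewrite size_exp_XsubC addnS/=; have := q0; rewrite -size_poly_gt0.
  by case: (size q) => // s _ [<-]; rewrite leq_addl.
have hX : horner_mx M ('X - a%:P) = M - a%:M.
  by rewrite rmorphB/= horner_mx_X horner_mx_C.
have u0 : (v *m (M - a%:M) ^+ m <= kermxpoly M (('X - a%:P) ^+ k) :&: kermxpoly M q)%MS.
  rewrite sub_capmx; apply/andP; split; apply/sub_kermxP.
    rewrite rmorphXn/= hX -mulmxA mulmxE -exprD addnC exprD -mulmxE mulmxA vk.
    by rewrite mul0mx.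
  rewrite -hX -rmorphXn -mulmxA mulmxE -rmorphM/= mulrC -cE.
  by rewrite Cayley_Hamilton mulmx0.
rewrite mxdirect_kermxpoly in u0; last first.
  by rewrite coprimep_expl// coprimep_sym coprimep_XsubC.
move: u0; rewrite submx0 => /eqP u0.
have -> : (M - a%:M) ^+ n.+1 = (M - a%:M) ^+ m * (M - a%:M) ^+ (n.+1 - m).
  by rewrite -exprD subnKC.
by rewrite -mulmxE mulmxA u0 mul0mx.
Qed.

(** Prepares the primary decomposition with pairwise coprime factors and the uniform exponent built
    into [geigenspace]. *)
Lemma char_poly_dvd_distinct (rs : seq F) :
  char_poly M = \prod_(z <- rs) ('X - z%:P) ->
  char_poly M %| \prod_(z <- undup rs) ('X - z%:P) ^+ n.+1.
Proof.
move=> cE; have sz : size rs = n.+1.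
  by have := size_char_poly M; rewrite cE size_prod_XsubC => -[].
rewrite cE -[X in X %| _]big_undup_iterop_count/=.
apply: (big_ind2 (fun p q => p %| q)) => // [p1 p2 q1 q2|z _]; first exact: dvdp_mul.
rewrite Monoid.iteropE -/(GRing.exp _ _).
have -> : iter (count_mem z rs) ( *%R ('X - z%:P)) 1 = ('X - z%:P) ^+ count_mem z rs.
  by elim: (count_mem _ _) => // i /= ->; rewrite exprS.
by rewrite dvdp_exp2l// -sz count_size.
Qed.

(** Each distinct root is repeated as often as the dimension of its generalized eigenspace. These
    spaces form a direct sum equal to the whole space, which gives the length of the list. *)
Lemma eigenvalue_listing : exists s : seq F,
  [/\ size s = n.+1, forall z, z \in s -> eigenvalue M z &
      forall z, count_mem z s = \rank (geigenspace M z)].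
Proof.
have [rs cE] := closed_field_poly_normal (char_poly M).
rewrite (eqP (char_poly_monic M)) scale1r in cE.
set ds := undup rs; pose N := size ds.
have evP z : eigenvalue M z = (z \in ds).
  by rewrite eigenvalue_root_char cE root_prod_XsubC mem_undup.
exists (flatten [seq nseq (\rank (geigenspace M z)) z | z <- ds]).
have inj : {in predT &, injective (fun i : 'I_N => ds`_i)}.
  by move=> i j _ _ /eqP; rewrite nth_uniq ?undup_uniq// => /eqP/val_inj.
have sum1 : (\sum_(i < N) geigenspace M ds`_i :=: 1%:M)%MS.
  have := char_poly_dvd_distinct cE; rewrite (big_nth 0) big_mkord => dv.
  apply: eqmx_trans (eqmx_sym _) (kermxpoly_min (dvdp_trans (mxminpoly_dvd_char M) dv)).
  apply: kermxpoly_prod => i j _ _ ij.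
  by rewrite coprimep_expr ?coprimep_expl// coprimep_XsubC root_XsubC (inj_in_eq inj).
have dir := mxdirect_sum_geigenspace M inj.
split.
- rewrite size_flatten /shape -map_comp sumnE big_map.
  under eq_bigr do rewrite /= size_nseq.
  by rewrite (big_nth 0) big_mkord -(mxdirectP dir)/= sum1 mxrank1.
- move=> z /flattenP[_ /mapP[w wds ->]]; rewrite mem_nseq => /andP[_ /eqP ->].
  by rewrite evP.
- move=> z; rewrite count_flatten -map_comp sumnE big_map.
  under eq_bigr do rewrite /= count_nseq/=.
  have [zds|zds] := boolP (z \in ds).
    rewrite (bigD1_seq z) ?undup_uniq//= eqxx mul1n big1 ?addn0// => w /negPf.
    by move=> ->; rewrite mul0n.
  rewrite big_seq big1 => [|w wds]; last first.
    by case: eqP => [wz|]; rewrite ?mul0n//; rewrite -wz wds in zds.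
  apply/esym/eqP; rewrite mxrank_eq0; apply/negPn.
  rewrite -evP in zds; apply: contra zds => /rowV0Pn[v + v0].
  rewrite geigenspaceE => /sub_kermxP vk.
  (* The last nonzero iterate of a generalized eigenvector is an eigenvector. *)
  have : exists k, v *m (M - z%:M) ^+ k == 0 by exists n.+1; rewrite vk.
  case/ex_minnP => -[|k]; first by rewrite expr0 mulmx1 (negPf v0).
  move=> /eqP vk0 kmin; apply/eigenvalueP; exists (v *m (M - z%:M) ^+ k).
    apply/eqP; rewrite -subr_eq0 -mul_mx_scalar -mulmxBr -mulmxA.
    by rewrite mulmxE -exprSr vk0.
  by apply/eqP => h; have := kmin k; rewrite h eqxx ltnn => /(_ isT).
Qed.

End GeneralizedEigenspaces.

(** * Perturbation of an orthonormal basis *)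

Section RieszPerturbation.
Context (R : realType) (H : completeNormedModType R[i]).
Context (ip : {dot H for Num.conj}) (hip : norm_from_dot ip).
Context (e : nat -> H) (e1 : forall k, rnorm (e k) = 1).
Context (eo : forall j k, j != k -> ip (e j) (e k) = 0).
Context (et : forall x, (forall k, ip x (e k) = 0) -> x = 0).
Context (f : nat -> H).
Context (fe : forall n, \sum_(0 <= k < n) rnorm (f k - e k) ^+ 2 <= 1 / 4).

(* The map [x |-> (<x, f k>)_k] differs from the coordinate isometry by an
   operator [E] of norm at most 1/2, hence it is bijective. *)
Lemma perturbed_basis :
  (forall x, (forall k, ip x (f k) = 0) -> x = 0) /\
  exists h : nat -> H, forall j k, ip (h j) (f k) = (j == k)%:R.
Proof.
have Ex x : exists y, (forall k, ip y (e k) = ip x (f k - e k)) /\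
    rnorm y ^+ 2 <= 1 / 4 * rnorm x ^+ 2.
  have [|y yE [yM _]] := @riesz_fischer R H ip hip e e1 eo
      (fun k => ip x (f k - e k)) (1 / 4 * rnorm x ^+ 2); last by exists y.
  move=> n; apply: (@le_trans _ _ ((\sum_(0 <= k < n) rnorm (f k - e k) ^+ 2) * rnorm x ^+ 2)).
    rewrite mulr_suml; apply: ler_sum => k _; rewrite -exprMn mulrC.
    apply: lerXn2r; rewrite ?nnegrE ?mulr_ge0 ?rnorm_ge0 ?modulus_ge0//.
    exact: modulus_ip_le.
  by rewrite ler_wpM2r ?sqr_ge0.
have /choice[E EP] := Ex.
have Ele x : rnorm (E x) <= 1 / 2 * rnorm x.
  rewrite -(@ler_pXn2r _ 2) ?nnegrE ?mulr_ge0 ?rnorm_ge0//.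
  apply: le_trans (EP x).2 _; rewrite exprMn.
  by have -> : (1 / 2) ^+ 2 = 1 / 4 :> R by field.
have EB x y : E x - E y = E (x - y).
  by apply: (eq_from_coords et) => k; rewrite ipBl !(EP _).1 ipBl.
split=> [x xf|].
  have Exx : E x = - x.
    apply: (eq_from_coords et) => k.
    by rewrite (EP x).1 ipBr xf sub0r -[in RHS]sub0r ipBl ip0l sub0r.
  have := Ele x; rewrite Exx rnormN => h.
  by apply/eqP; rewrite -rnorm_eq0 eq_le rnorm_ge0 andbT; lra.
have hx j : exists x, forall k, ip x (f k) = (j == k)%:R.
  (* A fixed point solves [x + E x = e j], and the [k]-th coordinate of the left side is
     [ip x (f k)]. The ball of radius [1] is preserved since its points have norm at most [2]. *)
  have [| | | | |x _ xE] := @contraction_fixpoint R H (fun x => e j - E x) (e j) 1 (1 / 2).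
  - by [].
  - lra.
  - by [].
  - move=> x xe; rewrite addrC addKr rnormN.
    have := Ele x; have := ler_rnormD (x - e j) (e j); rewrite subrK e1; lra.
  - by move=> x y _ _; rewrite opprB addrC subrKA EB (rnormBC x).
  exists x => k; have := congr1 (ip^~ (e k)) xE.
  rewrite /= ipBl (EP x).1 ipBr (ip_basis hip e1 eo) => /eqP.
  by rewrite opprB addrA subr_eq addrC => /eqP/addrI <-.
by have /choice[h hP] := hx; exists h => j k; exact: hP.
Qed.

End RieszPerturbation.

(** * Root vectors of an operator with a block triangular form *)

Lemma card_eq_seq (T : choiceType) (t : seq T) :
  uniq t -> ([set x | x \in t] #= `I_(size t))%card.
Proof.
elim: t => [_|x t ih /= /andP[xt ut]].
  by rewrite II0 card_eq0; apply/eqP; rewrite -subset0 => x.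
apply/eq_cardSP; exists x; first by rewrite /= mem_head.
suff -> : [set y | y \in x :: t] `\ x = [set y | y \in t] by exact: ih.
apply/seteqP; split=> y /=; first by rewrite inE => -[/orP[/eqP|]].
move=> yt; rewrite inE yt orbT; split=> // yx.
by rewrite yx (negPf xt) in yt.
Qed.

Section InvariantSubspaces.
Context (R : realType) (H : completeNormedModType R[i]).
Context (ip : {dot H for Num.conj}) (hip : norm_from_dot ip).
Context (f h : nat -> H).
Context (ft : forall x, (forall k, ip x (f k) = 0) -> x = 0).
Context (hf : forall j k, ip (h j) (f k) = (j == k)%:R).
Context (S : {linear H -> H}) (n0 : nat) (rho : nat -> R[i]).
Context (Sf : forall n x, (n0 <= n)%N -> ip (S x) (f n) = rho n * ip x (f n)).
Context (rho_inj : forall j k, (n0 <= j)%N -> (n0 <= k)%N -> rho j = rho k -> j = k).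

Let shift r x := S x - r *: x.

Definition root_vectors (r : R[i]) : set H := [set x | exists k, iter k (shift r) x = 0].

(** Forces a root vector for [r] to have zero coordinate at each [n >= n0] with [rho n] different
    from [r]. *)
Lemma coord_shift r k n x : (n0 <= n)%N ->
  ip (iter k (shift r) x) (f n) = (rho n - r) ^+ k * ip x (f n).
Proof.
move=> nn; elim: k => [|k ih]; first by rewrite expr0 mul1r.
rewrite iterS {1}/shift ipBl ipZl Sf// ih -mulrBl exprS; ring.
Qed.

(** The finite block: it has the basis [h i], [i < m], and is invariant under [S] as soon as
    [n0 <= m]. *)
Definition tail_annihilator m : set H := [set x | forall n, (m <= n)%N -> ip x (f n) = 0].

Section Fixed.
Context (m : nat) (n0m : (n0 <= m)%N).

Definition combination (v : 'rV[R[i]]_m) : H := \sum_i v 0 i *: h i.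

Definition coordinates (x : H) : 'rV[R[i]]_m := \row_i ip x (f i).

Lemma ip_combination v k : ip (combination v) (f k) =
  if insub k is Some i then v 0 i else 0.
Proof.
rewrite /combination ip_suml; case: insubP => [i _ ik|km].
  rewrite (bigD1 i)//= big1 => [|j ji]; first by rewrite addr0 ipZl hf ik eqxx mulr1.
  by rewrite ipZl hf -ik (inj_eq val_inj) (negPf ji) mulr0.
rewrite big1// => j _; rewrite ipZl hf; case: eqP => [jk|]; last by rewrite mulr0.
by rewrite -jk ltn_ord in km.
Qed.

Lemma combinationK : cancel combination coordinates.
Proof.
move=> v; apply/rowP => i; rewrite mxE ip_combination.
by rewrite insubT//= => im; congr (v 0 _); apply: val_inj.
Qed.

Lemma combination_tail v : tail_annihilator m (combination v).
Proof. by move=> n mn; rewrite ip_combination insubF// ltnNge mn. Qed.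

Lemma coordinatesK x : tail_annihilator m x -> combination (coordinates x) = x.
Proof.
move=> xm; apply/eqP; rewrite -subr_eq0; apply/eqP/ft => k; rewrite ipBl ip_combination.
case: insubP => [i _ ik|]; first by rewrite mxE ik subrr.
by rewrite -leqNgt => /xm ->; rewrite subrr.
Qed.

Lemma combinationM p (D : 'rV[R[i]]_p) (B : 'M[R[i]]_(p, m)) :
  combination (D *m B) = \sum_j D 0 j *: combination (row j B).
Proof.
rewrite /combination; under [RHS]eq_bigr do rewrite scaler_sumr.
rewrite exchange_big/=; apply: eq_bigr => i _; rewrite mxE scaler_suml.
by apply: eq_bigr => j _; rewrite !mxE scalerA.
Qed.

Lemma combination_eq0 v : (combination v == 0) = (v == 0).
Proof.
apply/eqP/eqP => [v0|->]; last by rewrite /combination big1// => i _; rewrite mxE scale0r.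
by rewrite -(combinationK v) v0; apply/rowP => i; rewrite !mxE ip0l.
Qed.

(** Row [i] holds the coordinates of [S (h i)], so that the matrix acts on row vectors from the
    right. *)
Definition compression : 'M[R[i]]_m := \matrix_(i, j) ip (S (h i)) (f j).

Lemma combination_compression v : S (combination v) = combination (v *m compression).
Proof.
have St x : tail_annihilator m x -> tail_annihilator m (S x).
  by move=> xm n mn; rewrite Sf ?(leq_trans n0m)// xm// mulr0.
rewrite -[LHS]coordinatesK; last exact/St/combination_tail.
congr combination; apply/rowP => j; rewrite !mxE /combination linear_sum ip_suml.
by apply: eq_bigr => i _; rewrite linearZ/= ipZl !mxE.
Qed.

Lemma combination_shift r v k :
  iter k (shift r) (combination v) = combination (v *m iter k (fun N => N *m (compression - r%:M)) 1%:M).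
Proof.
elim: k => [|k ih]; first by rewrite mulmx1.
rewrite !iterS ih /shift combination_compression mulmxA mulmxBr mul_mx_scalar.
rewrite /combination scaler_sumr -sumrB; apply: eq_bigr => i _.
by rewrite scalerA -scalerBl; congr (_ *: _); rewrite !mxE.
Qed.

End Fixed.

(** An eigenvector in the block of size [m] for [rho n], [n >= m], has vanishing coordinates from
    [n0] on because [rho] is injective there. So [rho n] is an eigenvalue of the fixed matrix of
    size [n0], and this happens for finitely many [n] only. *)
Lemma separating_index : exists m, (n0 < m)%N /\
  forall n x, (m <= n)%N -> tail_annihilator m x -> S x = rho n *: x -> x = 0.
Proof.
have [rs cE] := closed_field_poly_normal (char_poly (compression n0)).
rewrite (eqP (char_poly_monic _)) scale1r in cE.
have [N NP] : exists N, forall n, (N <= n)%N -> (n0 <= n)%N -> rho n \notin rs.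
  elim: (rs) => [|r t [N NP]]; first by exists 0%N.
  have [[j [jn jr]]|nj] := pselect (exists j, (n0 <= j)%N /\ rho j = r).
    exists (maxn N j.+1) => n; rewrite geq_max => /andP[Nn jln] n0n.
    rewrite inE negb_or NP// andbT; apply/eqP => nr.
    by have := rho_inj n0n jn (etrans nr (esym jr)) => nj; rewrite nj ltnn in jln.
  exists N => n Nn n0n; rewrite inE negb_or NP// andbT; apply/eqP => nr.
  by apply: nj; exists n.
(* The successor ensures a nonempty block, whose square matrices form a ring. *)
exists (maxn N n0.+1); split=> [|n x]; first by rewrite leq_max ltnSn orbT.
rewrite geq_max => /andP[Nn n0n] xm Sx; apply/eqP/negPn/negP => x0.
have xn0 : tail_annihilator n0 x.
  move=> k n0k; have [mk|km] := leqP (maxn N n0.+1) k; first exact: xm.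
  have := Sf x n0k; rewrite Sx ipZl => /eqP; rewrite -subr_eq0 -mulrBl mulf_eq0.
  case/orP=> [|/eqP//]; rewrite subr_eq0 => /eqP/(rho_inj (ltnW n0n) n0k) nk.
  by move: km; rewrite -nk leq_max !ltnS ltnNge Nn/= leqNgt n0n.
have := NP n Nn (ltnW n0n); rewrite -root_prod_XsubC -cE -eigenvalue_root_char.
move/negP; apply; apply/eigenvalueP; exists (coordinates n0 x).
  rewrite -[LHS](combinationK) -combination_compression// coordinatesK// Sx.
  by apply/rowP => i; rewrite !mxE ipZl.
by rewrite -combination_eq0 coordinatesK.
Qed.

(** The first [m] labels are the eigenvalues of the block, the others are the [rho n]; the two
    groups are disjoint by the choice of [m]. Hence the root vectors for [r] form a line if [r] is
    in the tail, and otherwise lie in the block. *)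
Lemma root_vectors_labels : exists (m0 : nat) (s : nat -> R[i]),
  [/\ forall n, (m0 <= n)%N -> (n0 <= n)%N /\ s n = rho n,
      forall n, exists2 x, x != 0 & S x = s n *: x &
      forall r, exists2 k, has_dim (root_vectors r) k &
        ([set n | s n = r] #= `I_k)%card].
Proof.
have [m [n0m mP]] := separating_index; case: m => [//|m'] in n0m mP *.
set m := m'.+1 in n0m mP; have n0m' : (n0 <= m)%N by exact: ltnW.
pose M : 'M[R[i]]_m'.+1 := compression m.
have shiftM r v k : iter k (shift r) (combination v) = combination (v *m (M - r%:M) ^+ k).
  rewrite combination_shift//; congr (combination (_ *m _)).
  by elim: k => [//|k ih]; rewrite iterS ih exprSr.
have [s [ssz sev scount]] := eigenvalue_listing M.
have sev' i : (i < m)%N -> exists2 v : 'rV_m, v *m M = s`_i *: v & v != 0.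
  by move=> im; apply/eigenvalueP/sev; rewrite mem_nth// ssz.
have sep i n : (i < m)%N -> (m <= n)%N -> s`_i != rho n.
  move=> im mn; have [v vM v0] := sev' i im; apply: contraNneq v0 => sr.
  rewrite -combination_eq0; apply/eqP/(mP n _ mn); first exact: combination_tail.
  rewrite combination_compression// vM sr /combination scaler_sumr.
  by apply: eq_bigr => i' _; rewrite mxE scalerA.
have headE r x : tail_annihilator m x -> (exists k, iter k (shift r) x = 0) <->
    (coordinates m x <= geigenspace M r)%MS.
  move=> xm; rewrite -{1}(coordinatesK xm); split=> [[k]|].
    rewrite shiftM => /eqP; rewrite combination_eq0 => /eqP.
    exact: root_vector_geigenspace.
  rewrite geigenspaceE => /sub_kermxP vk; exists m'.+1.
  by rewrite shiftM vk; apply/eqP; rewrite combination_eq0.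

(* [h n] is an eigenvector up to an error [y] in the block, where [S - rho n] is invertible;
   subtracting the solution [w] corrects it without changing the coordinates from [m] on. *)
have tail_ev n : (m <= n)%N -> exists v, [/\ S v = rho n *: v, ip v (f n) = 1 &
    forall k, (m <= k)%N -> k != n -> ip v (f k) = 0].
  move=> mn; have n0n := leq_trans n0m' mn.
  pose y := S (h n) - rho n *: h n.
  have ym : tail_annihilator m y.
    move=> k mk; rewrite /y ipBl ipZl Sf ?(leq_trans n0m')// hf.
    by have [->|_] := eqVneq n k; rewrite ?mulr0 ?subrr.
  have inv : M - (rho n)%:M \in unitmx.
    rewrite -row_free_unit -kermx_eq0; apply/negPn/negP => /rowV0Pn[v /sub_kermxP + v0].
    rewrite mulmxBr mul_mx_scalar => /eqP; rewrite subr_eq0 => /eqP vM.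
    move: v0; rewrite -combination_eq0 => /negP; apply; apply/eqP/(mP n _ mn).
      exact: combination_tail.
    rewrite combination_compression// vM /combination scaler_sumr.
    by apply: eq_bigr => i' _; rewrite mxE scalerA.
  pose w := combination (coordinates m y *m invmx (M - (rho n)%:M)).
  have wy : S w - rho n *: w = y.
    by rewrite -[LHS]/(iter 1 (shift (rho n)) w) shiftM expr1 mulmxKV// coordinatesK.
  have wm : tail_annihilator m w by exact: combination_tail.
  exists (h n - w); split=> [||k mk kn].
  - suff E : S (h n - w) - rho n *: (h n - w) = y - (S w - rho n *: w).
      by apply/eqP; rewrite -subr_eq0 E wy subrr.
    rewrite linearB scalerBr !opprB [rho n *: w - rho n *: h n]addrC addrACA.
    by rewrite [- S w + _]addrC.
  - by rewrite ipBl hf eqxx wm// subr0.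
  - by rewrite ipBl hf eq_sym (negPf kn) wm// subr0.
exists m, (fun n => if (n < m)%N then s`_n else rho n); split.
- by move=> n mn; rewrite ltnNge mn (leq_trans n0m').
- move=> n; case: ifP => nm.
    have [v vM v0] := sev' n nm; exists (combination v); first by rewrite combination_eq0.
    rewrite combination_compression// vM /combination scaler_sumr.
    by apply: eq_bigr => i' _; rewrite mxE scalerA.
  have [|v [vE vn _]] := tail_ev n; first by rewrite leqNgt nm.
  exists v => //; apply/eqP => v0; move: vn; rewrite v0 ip0l => /esym/eqP.
  by rewrite oner_eq0.
move=> r; have [[n [mn rn]]|nr] := pselect (exists n, (m <= n)%N /\ rho n = r).
  have n0n := leq_trans n0m' mn.
  exists 1%N; last first.
    suff -> : [set k | (if (k < m)%N then s`_k else rho k) = r] = [set n] by exact: card_set1.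
    apply/seteqP; split=> k /=; last by move=> ->; rewrite ltnNge mn.
    case: ifP => km; first by rewrite -rn => /eqP; rewrite (negPf (sep _ _ km mn)).
    by rewrite -rn; apply: rho_inj => //; rewrite (leq_trans n0m')// leqNgt km.
  have [v [vE vn vk]] := tail_ev n mn.
  exists (fun=> v); first by move=> _; exists 1%N; rewrite /= /shift vE rn subrr.
  move=> x [k xk]; exists [ffun=> ip x (f n)]; split.
    rewrite big_ord1 ffunE; apply/eqP; rewrite -subr_eq0; set y := x - _.
    have ym : tail_annihilator m y.
      move=> j mj; rewrite /y ipBl ipZl; have [->|jn] := eqVneq j n.
        by rewrite vn mulr1 subrr.
      rewrite vk// mulr0 subr0; have := coord_shift r k x (leq_trans n0m' mj).
      rewrite xk ip0l => /esym/eqP; rewrite mulf_eq0 expf_eq0 subr_eq0 => /orP[|/eqP//].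
      move=> /andP[_ /eqP]; rewrite -rn => /(rho_inj (leq_trans n0m' mj) n0n) jn'.
      by rewrite jn' eqxx in jn.
    have lin j a x1 x2 : iter j (shift r) (x1 - a *: x2) =
        iter j (shift r) x1 - a *: iter j (shift r) x2.
      elim: j => [//|j ih]; rewrite !iterS ih /shift linearB linearZ/= !scalerBr.
      by rewrite !scalerA [r * a]mulrC !opprB addrACA [- _ + _]addrC addrACA.
    have yk : iter k.+1 (shift r) y = 0.
      rewrite lin; have -> : iter k.+1 (shift r) v = 0.
        rewrite iterSr /shift vE rn subrr; elim: (k) => //= j ->.
        by rewrite linear0 scaler0 subr0.
      by rewrite scaler0 subr0 iterS xk /shift linear0 scaler0 subr0.
    (* [y] is a root vector for [rho n] inside the block. If it were nonzero, its last nonzero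
       iterate would be an eigenvector there, excluded by the choice of [m]. *)
    apply/negPn/negP => y0.
    have : exists k, iter k (shift r) y == 0 by exists k.+1; rewrite yk.
    case/ex_minnP=> -[|j]; first by rewrite /= (negPf y0).
    move=> /eqP jy jmin; have : iter j (shift r) y == 0; last first.
      by move/jmin; rewrite ltnn.
    apply/eqP/(mP n _ mn).
      move=> i mi; rewrite coord_shift ?(leq_trans n0m')//.
      by rewrite ym// mulr0.
    by apply/eqP; rewrite -subr_eq0 rn; apply/eqP.
  move=> c xc; apply/ffunP => i; rewrite ffunE xc ord1 big_ord1.
  by rewrite ipZl vn mulr1.
have rootE x : (exists k, iter k (shift r) x = 0) -> tail_annihilator m x.
  move=> [k xk] j mj; have := coord_shift r k x (leq_trans n0m' mj).
  rewrite xk ip0l => /esym/eqP; rewrite mulf_eq0 expf_eq0 subr_eq0 => /orP[|/eqP//].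
  by move=> /andP[_ /eqP jr]; exfalso; apply: nr; exists j.
pose G := row_base (geigenspace M r).
exists (\rank (geigenspace M r)).
  exists (fun i => combination (row i G)) => [i|x xr].
    apply/(headE r); first exact: combination_tail.
    by rewrite combinationK (submx_trans (row_sub _ _))// eq_row_base.
  have xm := rootE x xr; have xG := (headE r x xm).1 xr.
  have /submxP[D xD] : (coordinates m x <= G)%MS by rewrite eq_row_base.
  exists [ffun i => D 0 i]; split.
    rewrite -[LHS](coordinatesK xm) xD combinationM.
    by apply: eq_bigr => i _; rewrite ffunE.
  move=> c xc; pose D' : 'rV_(\rank (geigenspace M r)) := \row_i c i.
  have : D *m G = D' *m G.
    rewrite -[RHS]combinationK combinationM -xD; congr coordinates.
    by rewrite {1}xc; apply: eq_bigr => i _; rewrite mxE.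
  move=> /(row_free_inj (row_base_free _)) DD; apply/ffunP => i.
  by rewrite ffunE DD mxE.
pose t := [seq n <- iota 0 m | s`_n == r].
have -> : \rank (geigenspace M r) = size t.
  rewrite size_filter -scount -[s in LHS](mkseq_nth 0) ssz /mkseq count_map.
  exact: eq_count.
suff -> : [set k | (if (k < m)%N then s`_k else rho k) = r] = [set x | x \in t].
  by apply: card_eq_seq; rewrite filter_uniq ?iota_uniq.
apply/seteqP; split=> k /=; rewrite mem_filter mem_iota add0n leq0n/=.
  case: ifP => km; first by move=> ->; rewrite eqxx.
  by move=> rk; exfalso; apply: nr; exists k; rewrite leqNgt km.
by move=> /andP[/eqP kr ->].
Qed.

End InvariantSubspaces.

(** * The resolvent of the perturbed operator *)

Section ResolventSpectrum.
Context (R : realType) (H : completeNormedModType R[i]).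
Context (ip : {dot H for Num.conj}) (hip : norm_from_dot ip).

(* Testing against all vectors turns identities in [H] into ring identities. *)
Lemma eq_from_ip x y : (forall w, ip x w = ip y w) -> x = y.
Proof.
move=> xy; apply/eqP; rewrite -subr_eq0 -rnorm_eq0 -sqrf_eq0.
by apply/eqP/(@complexI R); rewrite -(ipxx hip) ipBl xy subrr.
Qed.

Context (B : operator H) (z : R[i]) (S : {linear H -> H}).
Context (BS : forall y, dom B (S y) /\ B (S y) - z *: S y = y).
Context (SB : forall x, dom B x -> S (B x - z *: x) = x).

Lemma resolvent_inj x : S x = 0 -> x = 0.
Proof. by move=> Sx; rewrite -(BS x).2 Sx op0 scaler0 subr0. Qed.

Lemma resolvent_shift w y : dom B y ->
  S (B y - w *: y) = y - (w - z) *: S y.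
Proof.
move=> By; rewrite -[X in _ = X - _](SB By) -linearZ -linearB; congr (S _).
by apply: eq_from_ip => v; rewrite !(ipBl, ipZl); ring.
Qed.

Lemma eigenvalue_resolvent s x : x != 0 -> S x = s *: x ->
  s != 0 /\ is_eigenvalue B (z + s^-1).
Proof.
move=> x0 Sx; have s0 : s != 0.
  apply: contraNneq x0 => s0; rewrite s0 scale0r in Sx.
  by apply/eqP; exact: resolvent_inj.
have [BSx Ex] := BS x; have xE : x = s^-1 *: S x by rewrite Sx scalerA mulVf// scale1r.
have Bx : dom B x by rewrite xE; exact: op_domZ.
split=> //; exists x; split=> //.
apply: eq_from_ip => v; have := congr1 (ip^~ v) Ex.
rewrite Sx opZ// /= !(ipBl, ipZl) mulrDl => xv.
by rewrite -[in s^-1 * _]xv; field.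
Qed.

Lemma resolvent_eigenvalue w y : dom B y -> y != 0 -> B y = w *: y ->
  w != z /\ S y = (w - z)^-1 *: y.
Proof.
move=> By y0 Ey; have := resolvent_shift w By.
rewrite Ey subrr linear0 => /esym/eqP; rewrite subr_eq0 => /eqP yE.
have wz : w - z != 0 by apply: contraNneq y0 => wz; rewrite yE wz scale0r.
by rewrite -subr_eq0; split=> //; rewrite {2}yE scalerA mulVf// scale1r.
Qed.

(** On the domain, [S - r] equals [- r S (B - w)] with [S] injective and commuting with [S - r], so
    the powers of [S - r] and of [B - w] have the same kernels. *)
Lemma root_subspace_resolvent w : w != z ->
  root_subspace B w = root_vectors S (w - z)^-1.
Proof.
rewrite -subr_eq0 => wz; set r := (w - z)^-1.
pose G x := B x - w *: x; pose sh x := S x - r *: x.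
have shG y : dom B y -> sh y = - r *: S (G y).
  move=> By; rewrite /G resolvent_shift// scalerBr scalerA mulNr mulVf//.
  by rewrite scaleN1r opprK addrC scaleNr.
have itS k a x : iter k sh (a *: S x) = a *: S (iter k sh x).
  elim: k => [//|k ih]; rewrite !iterS ih; set u := iter k sh x; rewrite /sh.
  have -> : S (a *: S u) = a *: S (S u) by rewrite linearZ.
  have -> : S (S u - r *: u) = S (S u) - r *: S u by rewrite linearB linearZ.
  by apply: eq_from_ip => v; rewrite !(ipBl, ipZl); ring.
(* Root vectors of [S] are in the domain automatically: [x] is a combination of [S x], which is in
   it, and of the next iterate. *)
have sh_dom k y : dom B (iter k sh y) -> dom B y.
  elim: k => [//|k ih]; rewrite iterS => shd; apply: ih; set x := iter k sh y in shd *.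
  have -> : x = (w - z) *: (S x - sh x).
    by rewrite /sh subKr scalerA divff// scale1r.
  by apply: op_domZ; apply: op_domB => //; exact: (BS x).1.
apply/seteqP; split=> y.
  move=> [_ [k [kd ky]]]; elim: k y kd ky => [|k ih] y kd ky.
    by exists 0%N; exact: ky.
  have By : dom B y by exact: (kd 0%N).
  have [||k' k'P] := ih (G y).
  - by move=> j jk; have := kd j.+1 jk; rewrite iterSr.
  - by have := ky; rewrite iterSr.
  exists k'.+1; rewrite iterSr -[S y - _]/(sh y) shG//.
  by rewrite -[iter _ _ _]/(iter k' sh _) itS [iter k' sh _]k'P linear0 scaler0.
move=> [k]; rewrite -[iter _ _ _]/(iter k sh y) => ky.
have By : dom B y by apply: (sh_dom k); rewrite ky; exact: dom0.
elim: k y ky By => [|k ih] y ky By.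
  by split=> //; exists 0%N; split.
split=> //; have Gk : iter k sh (G y) = 0.
  apply: resolvent_inj; apply/eqP.
  have : - r *: S (iter k sh (G y)) = 0 by rewrite -itS -shG// -iterSr.
  by move/eqP; rewrite scaler_eq0 oppr_eq0 invr_eq0 (negPf wz).
have BG : dom B (G y) by apply: (sh_dom k); rewrite Gk; exact: dom0.
have [_ [k' [k'd k'P]]] := ih _ Gk BG.
exists k'.+1; split; last by rewrite iterSr.
by case=> [//|j] jk; rewrite iterSr; exact: k'd.
Qed.

End ResolventSpectrum.

Section Perturbed.
Context (R : realType) (H : completeNormedModType R[i]).
Context (ip : {dot H for Num.conj}) (hip : norm_from_dot ip).
Context (A : operator H) (hA : self_adjoint ip A) (phi psi : H).

(** [ip (A x) x] is real, so the imaginary part of the product of the right-hand vector with [x] has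
    modulus [t * rnorm x ^+ 2]. *)
Lemma nonreal_bound (t : R) x : 0 < t -> dom A x ->
  t * rnorm x <= rnorm (A x - (t%:C%C * 'i%C) *: x).
Proof.
move=> t0 Ax; have [->|x0] := eqVneq x 0; first by rewrite rnorm0 mulr0 rnorm_ge0.
have n0 : 0 < rnorm x by rewrite rnorm_gt0.
rewrite -(ler_pM2r n0); apply: le_trans (modulus_ip_le hip _ _).
apply: le_trans (ler_Im_modulus _).
rewrite ipBl ipZl (ipxx hip).
have : ip (A x) x = (ip (A x) x)^* by rewrite {1}(op_symmetric hA)// -ipC.
case: (ip (A x) x) => a b [] /eqP; rewrite -addr_eq0 -mulr2n mulrn_eq0/= => /eqP ->.
rewrite ?(mulr0, mul0r, add0r, mulr1, subr0, addr0, mul1r) normrN.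
by rewrite -mulrA -expr2 ger0_norm// mulr_ge0 ?sqr_ge0// ltW.
Qed.

(** The Sherman-Morrison formula: a rank-one correction of the resolvent of [A]. By [nonreal_bound]
    the norm of [S psi] is at most [rnorm psi / t], so the assumption on [t] keeps the denominator
    [F] away from zero. *)
Lemma perturbed_resolvent (t : R) : rnorm phi * rnorm psi < t ->
  in_resolvent_set A (t%:C%C * 'i%C) ->
  exists S : {linear H -> H},
    let B := rank_one_perturbation ip A phi psi in
    (forall y, dom B (S y) /\ B (S y) - (t%:C%C * 'i%C) *: S y = y) /\
    (forall x, dom B x -> S (B x - (t%:C%C * 'i%C) *: x) = x).
Proof.
set z := (_ * 'i%C); move=> tn [S [_ AS SA]].
have t0 : 0 < t by rewrite (le_lt_trans _ tn)// mulr_ge0 ?rnorm_ge0.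
pose F := 1 + ip (S psi) phi.
have F0 : F != 0.
  rewrite -modulus_gt0; have := ler_modulusB 1 (- ip (S psi) phi).
  rewrite opprK modulus1 modulusN -/F; apply: lt_le_trans; rewrite subr_gt0.
  rewrite (le_lt_trans (modulus_ip_le hip _ _))// -(ltr_pM2l t0) mulr1.
  apply: le_lt_trans tn; rewrite mulrA [leRHS]mulrC ler_wpM2r ?rnorm_ge0//.
  by have [h1 h2] := AS psi; have := nonreal_bound t0 h1; rewrite h2.
pose T y := S y - (ip (S y) phi / F) *: S psi.
have Tlin : linear T.
  move=> a x y; rewrite /T linearP ipDl ipZl mulrDl scalerDl -mulrA -scalerA.
  by rewrite scalerBr opprD addrACA.
pose TL : {linear H -> H} := HB.pack T (GRing.isLinear.Build _ _ _ _ T Tlin).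
exists TL => /=; split=> [y|x Ax].
  have [Ay yE] := AS y; have [Ap pE] := AS psi.
  have AT : dom A (T y) by apply: op_domB => //; exact: op_domZ.
  split=> //; have Tphi : ip (T y) phi = ip (S y) phi / F.
    rewrite /T ipBl ipZl; have -> : ip (S psi) phi = F - 1 by rewrite /F addrC addKr.
    by field.
  rewrite Tphi /T opB//; last exact: op_domZ.
  rewrite opZ//; apply: (eq_from_ip hip) => v.
  have := congr1 (ip^~ v) yE; have := congr1 (ip^~ v) pE.
  rewrite /= !(ipBl, ipDl, ipZl) => <- <-; ring.
have xE := SA x Ax.
have E : S (A x + ip x phi *: psi - z *: x) = x + ip x phi *: S psi.
  by rewrite addrAC linearD xE linearZ.
rewrite /T E ipDl ipZl.
have -> : ip (S psi) phi = F - 1 by rewrite /F addrC addKr.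
apply: (eq_from_ip hip) => v; rewrite !(ipBl, ipDl, ipZl); field.
exact: F0.
Qed.

End Perturbed.

(** * Labelling the eigenvalues *)

Section SequenceIndexed.
Context (R : realType) (H : completeNormedModType R[i]).
Context (ip : {dot H for Num.conj}) (hip : norm_from_dot ip).
Context (A : operator H) (hA : self_adjoint ip A).
Context (l : nat -> R) (d : R) (d0 : 0 < d).
Context (sep : forall j k, j != k -> d <= `|l j - l k|).
Context (resA : forall z : R[i], (forall k, z != (l k)%:C%C) -> in_resolvent_set A z).
Context (simA : forall k, simple_eigenvalue A (l k)%:C%C).
Context (phi psi : H).
Let B := rank_one_perturbation ip A phi psi.

Lemma eigenvector_root_subspace (T : operator H) z x :
  dom T x -> T x = z *: x -> root_subspace T z x.
Proof.
move=> Tx Ex; split=> //; exists 1%N; split; first by case.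
by rewrite /= Ex subrr.
Qed.

Lemma normalized_eigenvectors : exists e : nat -> H,
  (forall k, [/\ dom A (e k), rnorm (e k) = 1 & A (e k) = (l k)%:C%C *: e k]) /\
  (forall k x, dom A x -> A x = (l k)%:C%C *: x -> x = ip x (e k) *: e k).
Proof.
have h k : exists e : H, [/\ dom A e, rnorm e = 1, A e = (l k)%:C%C *: e &
    forall x, dom A x -> A x = (l k)%:C%C *: x -> x = ip x e *: e].
  have [[y [Ay y0 Ey]] [b _ bP]] := simA k.
  have n0 : 0 < rnorm y by rewrite rnorm_gt0.
  pose e := ((rnorm y)^-1)%:C%C *: y.
  have e1 : rnorm e = 1.
    by rewrite rnormZ modulus_real gtr0_norm ?invr_gt0// mulVf// gt_eqF.
  have Ae : dom A e by exact: op_domZ.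
  have Ee : A e = (l k)%:C%C *: e by rewrite opZ// Ey !scalerA mulrC.
  have line x : dom A x -> A x = (l k)%:C%C *: x -> exists c : R[i], x = c *: b 0.
    move=> Ax Ex; have [c [-> _]] := bP _ (eigenvector_root_subspace Ax Ex).
    by exists (c 0); rewrite big_ord1.
  exists e; split=> // x Ax Ex.
  have [c1 eE] := line _ Ae Ee; have [c2 xE] := line _ Ax Ex.
  have c10 : c1 != 0.
    apply/eqP => c10; move: e1; rewrite eE c10 scale0r rnorm0 => /esym/eqP.
    by rewrite oner_eq0.
  have xe : x = (c2 / c1) *: e by rewrite eE scalerA mulfVK.
  by rewrite {2}xe ipZl (ipxx hip) e1 expr1n mulr1.
have /choice[e eP] := h.
exists e; split=> [k|k x Ax Ex]; first by have [] := eP k.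
by have [_ _ _ eE] := eP k; exact: eE.
Qed.

Lemma nonreal_neq (t : R) k : 0 < t -> (t%:C * 'i)%C != (l k)%:C%C.
Proof.
move=> t0; apply/eqP => /(congr1 (@complex.Im R))/=.
by rewrite mulr1 mul0r addr0 => tE; rewrite tE ltxx in t0.
Qed.

Lemma sequence_labels : exists (m0 : nat) (mu : nat -> R[i]),
  [/\ forall n, is_eigenvalue B (mu n),
      forall w, is_eigenvalue B w -> exists2 m, has_alg_mult B w m &
        ([set n | mu n = w] #= `I_m)%card,
      exists M : R, forall n, \sum_(0 <= k < n) modulus (mu k - (l k)%:C%C) <= M &
      forall j k, (m0 <= j)%N -> (m0 <= k)%N -> mu j = mu k -> j = k].
Proof.
have d_gt0 := d0.
have [e [eA kerA]] := normalized_eigenvectors.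
have resR (t : R) : (forall k, t != l k) -> in_resolvent_set A t%:C%C.
  by move=> tl; apply: resA => k; rewrite (inj_eq (@complexI R)) tl.
have et := eigenvectors_total hip hA d0 sep resR eA kerA.
have eo := eigenvectors_orthogonal hA d0 sep eA.
have e1 k : rnorm (e k) = 1 by have [] := eA k.
have eA' k : dom A (e k) /\ A (e k) = (l k)%:C%C *: e k by have [] := eA k.
have [n0 [K [f [mu [K0 fP]]]]] := tail_eigenvectors hip e1 eo et hA eA' d0 sep phi psi.
have [n1 [n01 n1P]] : exists n1, (n0 <= n1)%N /\
    forall n, \sum_(n1 <= k < n) K ^+ 2 * modulus (ip psi (e k)) ^+ 2 <= 1 / 4.
  have [|||N NP] := @bounded_sums_cauchy R (fun k => K ^+ 2 * modulus (ip psi (e k)) ^+ 2)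
      (K ^+ 2 * rnorm psi ^+ 2) _ _ (1 / 4).
  - by move=> k; rewrite mulr_ge0 ?sqr_ge0.
  - by move=> n; rewrite -mulr_sumr ler_wpM2l ?sqr_ge0// bessel.
  - by rewrite divr_gt0.
  exists (maxn n0 N); split=> [|n]; first exact: leq_maxl.
  have [Nn|nN] := leqP (maxn n0 N) n; first by rewrite ltW// NP// leq_maxr.
  by rewrite big_geq ?divr_ge0// ltnW.
(* The threshold [n1] makes the total squared displacement at most [1/4], as [perturbed_basis]
   requires. *)
pose g k := if (k < n1)%N then e k else f k.
have fe n : \sum_(0 <= k < n) rnorm (g k - e k) ^+ 2 <= 1 / 4.
  have h k : rnorm (g k - e k) ^+ 2 <= 
      if (n1 <= k)%N then K ^+ 2 * modulus (ip psi (e k)) ^+ 2 else 0.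
    rewrite /g; case: ltnP => [_|nk]; first by rewrite subrr rnorm0 expr0n.
    have [_ _ _ _ fk] := fP k (leq_trans n01 nk).
    rewrite -exprMn; apply: lerXn2r; rewrite ?nnegrE ?rnorm_ge0//.
    by rewrite mulr_ge0 ?modulus_ge0.
  have [n1n|nn1] := leqP n1 n; last first.
    rewrite big_nat_cond big1 ?divr_ge0// => k /andP[/andP[_ kn] _].
    by rewrite /g (ltn_trans kn nn1) subrr rnorm0 expr0n.
  rewrite (@big_cat_nat _ _ _ n1)//= big_nat_cond big1 ?add0r; last first.
    by move=> k /andP[/andP[_ kn] _]; rewrite /g kn subrr rnorm0 expr0n.
  apply: le_trans (n1P n); apply: ler_sum_nat => k /andP[nk _].
  by have := h k; rewrite nk.
have [gt [h hg]] := perturbed_basis hip e1 eo et fe.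
(* Large enough for [perturbed_resolvent]; the summand [d] also keeps [z] away from the [mu n],
   whose imaginary parts are at most [d / 4]. *)
pose t := rnorm phi * rnorm psi + 1 + d.
have n00 := mulr_ge0 (rnorm_ge0 phi) (rnorm_ge0 psi).
have t0 : 0 < t by rewrite /t; lra.
have [|S [BS SB]] := @perturbed_resolvent R H ip hip A hA phi psi t _
    (resA (fun k => nonreal_neq k t0)); first by rewrite /t; lra.
set z := (_ * 'i%C) in BS SB.
have muz n : (n0 <= n)%N -> mu n - z != 0.
  move=> nn; have [_ _ ml _ _] := fP n nn; rewrite subr_eq0; apply/eqP => mz.
  have tl : t <= modulus (mu n - (l n)%:C%C).
    rewrite mz; apply: le_trans (ler_Im_modulus _); rewrite /z/=.
    by rewrite mulr1 mul0r addr0 subr0 gtr0_norm.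
  have td : rnorm phi * rnorm psi + 1 + d <= d / 4 := le_trans tl ml.
  lra.
pose rho n := (mu n - z)^-1.
(* The discs of radius [d / 4] around the [l n] are disjoint. *)
have mu_inj j k : (n0 <= j)%N -> (n0 <= k)%N -> mu j = mu k -> j = k.
  move=> nj nk mjk; have [_ _ mj _ _] := fP j nj; have [_ _ mk _ _] := fP k nk.
  apply/eqP/negPn/negP => jk; have := sep jk.
  rewrite -modulus_real rmorphB/=.
  have := ler_modulusD ((l j)%:C%C - mu k) (mu k - (l k)%:C%C).
  rewrite mjk in mj; rewrite subrKA [modulus (_ - mu k)]modulusBC; lra.
(* [x = (B - z) (S x)] is paired with the adjoint eigenvector [f n]; moving the operator to the
   right produces the factor [mu n - z]. *)
have Sg n x : (n1 <= n)%N -> ip (S x) (g n) = rho n * ip x (g n).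
  move=> nn; have n0n := leq_trans n01 nn; rewrite /g ltnNge nn/=.
  have [Af Ef _ _ _] := fP n n0n; have [BSx xE] := BS x.
  rewrite -{2}xE ipBl ipZl /=.
  rewrite ipDl ipZl (op_symmetric hA)//.
  have -> : ip (S x) (A (f n)) + ip (S x) phi * ip psi (f n) = mu n * ip (S x) (f n).
    rewrite -[mu n]conjCK -ipZr -Ef ipDr ipZr -(ipC ip psi); ring.
  by rewrite -mulrBl mulrA /rho mulVf ?mul1r// muz.
have rho_inj j k : (n1 <= j)%N -> (n1 <= k)%N -> rho j = rho k -> j = k.
  move=> nj nk /invr_inj/addIr; apply: mu_inj; exact: leq_trans n01 _.
have [m0 [s [s1 s2 s3]]] := root_vectors_labels gt hg Sg rho_inj.
have sE n : s n != 0 /\ is_eigenvalue B (z + (s n)^-1).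
  by have [x x0 xE] := s2 n; exact: (eigenvalue_resolvent hip BS x0 xE).
pose nu n := z + (s n)^-1.
have nuE n : (m0 <= n)%N -> (n0 <= n)%N /\ nu n = mu n.
  move=> mn; have [h1 h2] := s1 n mn; split; first exact: leq_trans n01 h1.
  by rewrite /nu h2 /rho invrK addrC subrK.
exists m0, nu; split.
- by move=> n; case: (sE n).
- move=> w [y [By y0 Ey]].
  have [wz Sy] := resolvent_eigenvalue hip SB By y0 Ey.
  have [m mdim mcard] := s3 (w - z)^-1; exists m.
    by rewrite /has_alg_mult (root_subspace_resolvent hip BS SB wz).
  suff -> : [set n | nu n = w] = [set n | s n = (w - z)^-1] by [].
  apply/seteqP; split=> n /=; first by move=> <-; rewrite /nu addrC addKr invrK.
  by move=> sn; rewrite /nu sn invrK addrC subrK.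
(* The finitely many head terms are kept as they are. In the tail, [2ab <= a^2 + b^2] and Bessel's
   inequality for [phi] and [psi] apply. *)
- exists (\sum_(0 <= k < m0) modulus (nu k - (l k)%:C%C) + (rnorm phi ^+ 2 + rnorm psi ^+ 2)).
  move=> n; apply: (@le_trans _ _ (\sum_(0 <= k < n) ((if (k < m0)%N then modulus (nu k - (l k)%:C%C) else 0) +
     (modulus (ip phi (e k)) ^+ 2 + modulus (ip psi (e k)) ^+ 2)))).
    apply: ler_sum => k _; case: ifP => km.
      by rewrite lerDl addr_ge0 ?sqr_ge0.
    have [nk nuk] : (n0 <= k)%N /\ nu k = mu k by apply: nuE; rewrite leqNgt km.
    have [_ _ _ + _] := fP k nk; rewrite add0r nuk => h1; apply: le_trans h1 _.
    have := sqr_ge0 (modulus (ip phi (e k)) - modulus (ip psi (e k))); lra.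
  rewrite !big_split/=; apply: lerD; last by apply: lerD; apply: bessel.
  have hh (m p : nat) : \sum_(m <= k < p) (if (k < m0)%N then modulus (nu k - (l k)%:C%C) else 0) >= 0.
    by apply: sumr_ge0 => k _; case: ifP => // _; exact: modulus_ge0.
  apply: (@le_trans _ _ (\sum_(0 <= k < maxn n m0)
      (if (k < m0)%N then modulus (nu k - (l k)%:C%C) else 0))).
    by rewrite [leRHS](@big_cat_nat _ _ _ n) ?leq_maxl//= lerDl.
  rewrite (@big_cat_nat _ _ _ m0) ?leq_maxr//= [X in _ + X]big_nat_cond [X in _ + X]big1 ?addr0.
    by rewrite le_eqVlt; apply/orP; left; apply/eqP/eq_big_nat => k /andP[_ ->].
  by move=> k /andP[/andP[mk _] _]; rewrite ltnNge mk.
- move=> j k mj mk; have [nj ->] := nuE j mj; have [nk ->] := nuE k mk.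
  exact: mu_inj.
Qed.

End SequenceIndexed.

(** * Transfer from sequences to the index set *)

(** Makes the index sets of semibounded and of unbounded operators uniform; the enumeration ignores
    the order of [I]. *)
Lemma enumerate_ints (I : set int) : (forall n : nat, I n%:Z) ->
  exists idx : nat -> int, set_bij [set: nat] I idx.
Proof.
move=> nI; have : (I #= [set: nat])%card.
  rewrite card_eqPle; split; first exact: countableP.
  have /card_eqPle[_ h] : (Posz @` [set: nat] #= [set: nat])%card.
    by apply: inj_card_eq => m n _ _ [].
  by apply: card_le_trans h _; apply: subset_card_le => _ [n _ <-].
move=> /card_set_bijP[g [_ g_inj g_surj]].
have /choice[idx idxP] : forall k, exists n, I n /\ g n = k.
  by move=> k; have [n In nk] := g_surj k Logic.I; exists n.
exists idx; split=> [k _|j k _ _ jk|n In]; first by case: (idxP k).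
  by rewrite -(idxP j).2 -(idxP k).2 jk.
exists (g n) => //; have [In' gn] := idxP (g n).
by apply: g_inj; rewrite ?inE.
Qed.

Lemma has_dim0 (R : realType) (H : completeNormedModType R[i]) (V : set H) v :
  has_dim V 0 -> V v -> v = 0.
Proof. by move=> [e _ h] /h[c [-> _]]; rewrite big_ord0. Qed.

Lemma increasing_gap (R : realType) (I : set int) (lambda : int -> R) (d : R) :
  (forall n, I n -> I (n + 1)) ->
  (forall m n, I m -> I n -> m < n -> lambda m < lambda n) ->
  (forall n, I n -> d <= `|lambda (n + 1) - lambda n|) ->
  forall m n, I m -> I n -> m != n -> d <= `|lambda m - lambda n|.
Proof.
move=> I1 mono gap m n Im In; wlog mn : m n Im In / m < n => [hw mn|_].
  have [h|h|h] := ltgtP m n; first exact: hw.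
    by rewrite distrC; apply: hw => //; rewrite lt_eqF.
  by rewrite h eqxx in mn.
have h1 : lambda (m + 1) <= lambda n.
  have [->//|m1n] := eqVneq (m + 1) n.
  by apply/ltW/mono => //; [exact: I1|lia].
have h2 := mono _ _ Im (I1 _ Im) ltac:(lia).
have := gap _ Im; rewrite gtr0_norm ?subr_gt0// => h3.
have h4 := mono _ _ Im In mn.
by rewrite distrC gtr0_norm ?subr_gt0//; lra.
Qed.

Theorem theorem3p1 (R : realType) (H : completeNormedModType R[i])
  (ip : {dot H for Num.conj}) (hip : norm_from_dot ip)
  (hsep : separable H) (hinf : infinite_dimensional H)
  (A : operator H) (hA : self_adjoint ip A)
  (I : set int) (hI : index_set ip A I)
  (lambda : int -> R) (hlambda : simple_discrete_spectrum A I lambda)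
  (hd : 0 < inf [set `|lambda (n + 1) - lambda n| | n in I])
  (phi psi : H) (hphi : phi != 0) (hpsi : psi != 0) :
  let B := rank_one_perturbation ip A phi psi in
  (exists mu : int -> R[i],
     labels_eigenvalues B I mu /\
     summable I (fun n => (complex.Re `|mu n - (lambda n)%:C%C|)%:E)) /\
  finite_set [set z | is_eigenvalue B z /\ ~ simple_eigenvalue B z].
Proof.
move=> B; have [_ simp mono spec] := hlambda.
have I0 (n : nat) : I n%:Z by case: hI => [[_ ->]|[_ [_ ->]]].
have I1 n : I n -> I (n + 1).
  by case: hI => [[_ ->]|[_ [_ ->]]]//= n0; rewrite addr_ge0.
set d := inf _ in hd.
have gap n : I n -> d <= `|lambda (n + 1) - lambda n|.
  by move=> In; apply: ge_inf; [exists 0 => _ [m _ <-]|exists n].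
have [idx [idxI idx_inj idx_surj]] := enumerate_ints I0.
have Iidx k : I (idx k) by exact: idxI.
have idx_injective : injective idx by move=> j k; apply: idx_inj; rewrite inE.
pose l k := lambda (idx k).
have sep j k : j != k -> d <= `|l j - l k|.
  move=> jk; apply: (increasing_gap I1 mono gap) => //.
  by rewrite (inj_eq idx_injective).
have resA z : (forall k, z != (l k)%:C%C) -> in_resolvent_set A z.
  move=> zl; apply: contrapT => zs; have : spectrum A z by [].
  rewrite spec => -[n In nz]; have [k _ kn] := idx_surj n In.
  by have := zl k; rewrite /l kn nz eqxx.
have simA k : simple_eigenvalue A (l k)%:C%C.
  by apply: simp; rewrite spec; exists (idx k).
have [m0 [mu [mu1 mu2 [M muM] mu_inj]]] :=
  sequence_labels hip hA hd sep resA simA phi psi.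
have invP n : exists k, I n -> idx k = n.
  by have [In|nI] := pselect (I n); [have [k _ kn] := idx_surj n In; exists k|exists 0%N].
have /choice[inv idxK] := invP.
have invK k : inv (idx k) = k by apply: idx_injective; rewrite idxK.
split.
  exists (mu \o inv); split; first split=> [n _|z /mu2[m mdim mcard]]; first exact: mu1.
    exists m => //.
    suff -> : [set n | I n /\ (mu \o inv) n = z] = idx @` [set k | mu k = z].
      by apply: card_eq_trans mcard; apply: inj_card_eq => j k _ _; apply: idx_injective.
    apply/seteqP; split=> n /=; first by move=> [In nz]; exists (inv n) => //; exact: idxK.
    by move=> [k kz <-]; rewrite invK.
  (* The terms are nonnegative, so the sum over [I] may be taken in the order of [idx] and is
     bounded by the bound [M] of the partial sums. *)
  rewrite /summable (reindex_esum [set: nat] I idx); last by split.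
  rewrite -nneseries_esumT; last by move=> n; exact: abse_ge0.
  apply: (@le_lt_trans _ _ M%:E); last exact: ltry.
  apply: lime_le; first by apply: is_cvg_nneseries => n _ _; exact: abse_ge0.
  apply: nearW => n; rewrite (eq_bigr (fun k => (modulus (mu k - (l k)%:C%C))%:E)).
    by rewrite sumEFin lee_fin.
  by move=> k _; rewrite /= invK ger0_norm ?modulus_ge0.
(* An eigenvalue that is none of the first [m0] labels has all its labels in the tail, where [mu] is
   injective; it is labelled only once, and its multiplicity is [1]. *)
apply: (@sub_finite_set _ _ (mu @` `I_m0)); last exact: finite_image.
move=> z [zB zns]; apply: contrapT => znm; apply: zns; split=> //.
have [m mdim mcard] := mu2 z zB.
have [y [By y0 Ey]] := zB.
have yr : root_subspace B z y by exact: eigenvector_root_subspace.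
case: m => [|m] in mdim mcard.
  by rewrite (has_dim0 mdim yr) eqxx in y0.
have m1 : ([set n | mu n = z] #= `I_1)%card.
  have /eq_cardSP[n nz _] := mcard.
  suff -> : [set n | mu n = z] = [set n] by exact: card_set1.
  have tail k : mu k = z -> (m0 <= k)%N.
    by move=> kz; rewrite leqNgt; apply/negP => km; apply: znm; exists k.
  apply/seteqP; split=> k /=; last by move=> ->.
  by move=> kz; apply: mu_inj; rewrite ?kz ?tail.
have /card_eq_II mE : (`I_1 #= `I_m.+1)%card.
  by apply: card_eq_trans mcard; rewrite card_eq_sym.
by rewrite /has_alg_mult mE.
Qed.
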